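(* Let $I$ be an infinite set and $\mu$ an ultrafilter on $I$. For every $i\in I$ let $\mathbb K_i$ be an $\mathcal L$-structure with an existential matroid $\mathrm{cl}_i$, with induced dimension $d_i$, and assume that the dimension is uniformly definable for the family $(\langle\mathbb K_i,\mathrm{cl}_i\rangle)_{i\in I}$. Let $\mathbb K=\prod_i\mathbb K_i/\mu$. Define a function $d$ from the sets definable in $\mathbb K$ to $\{-\infty\}\cup\mathbb N$ as follows: for a $\mathbb K$-definable set $X=\prod_{i\in I}X_i/\mu$ (and $l\in\{-\infty\}\cup\mathbb N$), $d(X)=l$ iff $d_i(X_i)=l$ for $\mu$-almost every $i\in I$. Then $d$ is a dimension function on $\mathbb K$. Let $\mathrm{cl}$ be the existential matroid induced by $d$. Then, for $a\in\mathbb K$ and a finite tuple $\bar b$ from $\mathbb K$ with representatives $(a_i)_{i\in I}$, $(\bar b_i)_{i\in I}$, $a\in\mathrm{cl}(\bar b)$ implies that $a_i\in\mathrm{cl}_i(\bar b_i)$ for $\mu$-almost every $i\in I$; but the converse implication is not true in general.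
   Context: Matroids. A monster model $\mathbb M$ of a complete theory $T$ is a $\kappa$-saturated, strongly $\kappa$-homogeneous model, $\kappa>|T|$ large; ''small'' means of cardinality $<\kappa$. A (finitary) matroid on $\mathbb M$ is an operator $\mathrm{cl}:\mathcal P(\mathbb M)\to\mathcal P(\mathbb M)$ with: $X\subseteq \mathrm{cl}(X)$; $X\subseteq Y\Rightarrow \mathrm{cl}(X)\subseteq \mathrm{cl}(Y)$; $\mathrm{cl}(\mathrm{cl}(X))=\mathrm{cl}(X)$; $\mathrm{cl}(X)=\bigcup\{\mathrm{cl}(A): A\subseteq X \text{ finite}\}$; and exchange: $a\in \mathrm{cl}(X\cup\{c\})\setminus \mathrm{cl}(X)$ implies $c\in\mathrm{cl}(X\cup\{a\})$. A formula $\phi(x,\bar y)$ without parameters, $x$ a single variable, is $x$-narrow if for all $a,\bar b$, $\mathbb M\models\phi(a,\bar b)$ implies $a\in\mathrm{cl}(\bar b)$. The matroid is definable if for every $A$, $\mathrm{cl}(A)$ is the union of the sets $\phi(\mathbb M,\bar a)$ with $\phi$ $x$-narrow and $\bar a$ a finite tuple from $A$. It satisfies Existence if for every element $a$ and all small $B,C$ with $a\notin\mathrm{cl}(B)$ there is $a'$ with the same type as $a$ over $B$ and $a'\notin\mathrm{cl}(B\cup C)$. The trivial matroid is $\mathrm{cl}^0(X)=\mathbb M$ for all $X$. An existential matroid is a definable matroid that satisfies Existence and is not trivial. An existential matroid on an arbitrary structure $\mathbb K_i$ means the restriction to $\mathbb K_i$ ($X\mapsto\mathrm{cl}(X)\cap\mathbb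 K_i$) of an existential matroid on a monster model $\mathbb M_i\succeq\mathbb K_i$ of the theory of $\mathbb K_i$. The induced dimension of a nonempty set $V\subseteq\mathbb M^n$ definable over a small $A$ is the maximum over $\bar b\in V$ of the cardinality of a maximal subtuple of $\bar b$ that is $\mathrm{cl}$-independent over $A$; $\emptyset$ has dimension $-\infty$; the dimension of a $\mathbb K_i$-definable set is that of its interpretation in $\mathbb M_i$. Uniform definability: for every $\mathcal L$-formula $\phi(\bar x,\bar y)$ without parameters, $\bar x=(x_1,\dots,x_n)$, $\bar y=(y_1,\dots,y_m)$, and every $l\le n$, there is a formula $\psi(\bar y)$ without parameters such that for every $i\in I$, $\{\bar y\in\mathbb K_i^m: d_i(\phi(\mathbb K_i,\bar y))=l\}=\psi(\mathbb K_i)$. Dimension functions. A dimension function on a structure $\mathbb K$ is a function $d$ from the sets definable in $\mathbb K$ (with parameters) to $\{-\infty\}\cup\mathbb N$ such that for all $m$ and definable $S,S_1,S_2\subseteq\mathbb K^m$: (Dim 1) $d(S)=-\infty$ iff $S=\emptyset$, $d(\{a\})=0$ for every $a\in\mathbb K$, $d(\mathbb K)=1$; (Dim 2) $d(S_1\cup S_2)=\max(d(S_1),d(S_2))$; (Dim 3) $d(S^\sigma)=d(S)$ for every permutation $\sigma$ of the coordinates; (Dim 4) for $U\subseteq\mathbb K^{m+1}$ definable and $i=0,1$, the set $U(i):=\{x\in\mathbb K^m:d(U_x)=i\}$ is definable with the same parameters as $U$, and $d(U\cap\pi^{-1}(U(i)))=d(U(i))+i$, where $\pi:\mathbb K^{m+1}\to\mathbb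 K^m$ is the projection onto the first $m$ coordinates. The (existential) matroid induced by $d$ is: $b\in\mathrm{cl}(A)$ iff there is $X\subseteq\mathbb K$ definable with parameters in $A$ with $d(X)=0$ and $b\in X$.
   Formalization: The formal theorem also assumes that, for each i, the dimension is definable in the monster model M_i (for parameters in M_i, not only in K_i); without this d can fail (Dim 4), e.g. for an equivalence relation with exactly one class of each finite size. *)

(* Defs.v *)
From mathcomp Require Import all_boot perm generic_quotient.
From mathcomp Require Import boolp classical_sets functions cardinality filter.

Set Implicit Arguments.
Unset Strict Implicit.
Unset Printing Implicit Defensive.

Local Open Scope classical_set_scope.
Local Open Scope card_scope.
Local Open Scope quotient_scope.

Record language := Language {
  fsym : Type; farity : fsym -> nat;
  rsym : Type; rarity : rsym -> nat }.

(* [n] bounds the free variables, which are the elements of ['I_n]. *)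
Inductive term (L : language) (n : nat) : Type :=
| Var of 'I_n
| App (f : fsym L) of ('I_(farity f) -> term L n).

(* [All] binds variable [ord0] of its body; the variable [i] outside becomes
   [lift ord0 i] inside. *)
Inductive formula (L : language) : nat -> Type :=
| Bot n : formula L n
| Eq n : term L n -> term L n -> formula L n
| Rel n (r : rsym L) : ('I_(rarity r) -> term L n) -> formula L n
| Imp n : formula L n -> formula L n -> formula L n
| All n : formula L n.+1 -> formula L n.

Record structure (L : language) := Structure {
  carrier :> Type;
  finterp : forall f : fsym L, ('I_(farity f) -> carrier) -> carrier;
  rinterp : forall r : rsym L, ('I_(rarity r) -> carrier) -> Prop }.

(* Tuples in [T^n] are functions ['I_n -> T]. *)
Definition tcons (T : Type) n (a : T) (v : 'I_n -> T) : 'I_n.+1 -> T :=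
  fun i => if unlift ord0 i is Some j then v j else a.

Definition tcat (T : Type) n m (x : 'I_n -> T) (y : 'I_m -> T) : 'I_(n + m) -> T :=
  fun k => match fintype.split k with inl i => x i | inr j => y j end.

Fixpoint teval L (M : structure L) n (v : 'I_n -> M) (t : term L n) : M :=
  match t with
  | Var i => v i
  | App f ts => finterp (fun j => teval v (ts j))
  end.

Fixpoint sat L (M : structure L) n (phi : formula L n) : ('I_n -> M) -> Prop :=
  match phi in formula _ n return ('I_n -> M) -> Prop with
  | Bot _ => fun _ => False
  | Eq _ s t => fun v => teval v s = teval v t
  | Rel _ r ts => fun v => rinterp (fun j => teval v (ts j))
  | Imp _ p q => fun v => sat p v -> sat q v
  | All _ p => fun v => forall a, sat p (tcons a v)
  end.

Definition theory L (M : structure L) : set (formula L 0) :=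
  [set phi | forall v : 'I_0 -> M, sat phi v].

Definition elementary L (K M : structure L) (e : K -> M) : Prop :=
  forall n (phi : formula L n) (v : 'I_n -> K), sat phi (e \o v) <-> sat phi v.

Definition automorphism L (M : structure L) (g : M -> M) : Prop :=
  [/\ bijective g,
      forall f (v : 'I_(farity f) -> M), g (finterp v) = finterp (g \o v)
    & forall r (v : 'I_(rarity r) -> M), rinterp (g \o v) <-> rinterp v].

(* The set [phi(M^n, b)]. *)
Definition defset L (M : structure L) n m (phi : formula L (n + m)) (b : 'I_m -> M)
  : set ('I_n -> M) := [set x | sat phi (tcat x b)].

Definition definable_over L (M : structure L) (A : set M) n (X : set ('I_n -> M)) : Prop :=
  exists m (phi : formula L (n + m)) (b : 'I_m -> M), range b `<=` A /\ X = defset phi b.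

Definition definable L (M : structure L) n (X : set ('I_n -> M)) : Prop :=
  definable_over [set: M] X.

Definition same_type L (M : structure L) (B : set M) (a a' : M) : Prop :=
  forall m (phi : formula L m.+1) (b : 'I_m -> M), range b `<=` B ->
    sat phi (tcons a b) <-> sat phi (tcons a' b).

(* Cardinals are represented by types: [kappa] stands for its cardinality. *)
Definition card_lt T U (A : set T) (B : set U) : Prop := A #<= B /\ ~ (B #<= A).

Definition small (kappa : Type) T (A : set T) : Prop := card_lt A [set: kappa].

(* Formulas in one variable with parameters in [M]. *)
Definition pformula1 L (M : structure L) : Type :=
  {m : nat & (formula L m.+1 * ('I_m -> M))%type}.

Definition psat L (M : structure L) (p : pformula1 M) (a : M) : Prop :=
  sat (projT2 p).1 (tcons a (projT2 p).2).

Definition saturated (kappa : Type) L (M : structure L) : Prop :=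
  forall (B : set M) (p : set (pformula1 M)), small kappa B ->
    (forall q, p q -> range (projT2 q).2 `<=` B) ->
    (forall F, finite_set F -> F `<=` p -> exists a, forall q, F q -> psat q a) ->
    exists a, forall q, p q -> psat q a.

Definition strongly_homogeneous (kappa : Type) L (M : structure L) : Prop :=
  forall (A : set M) (f : M -> M), small kappa A ->
    (forall n (phi : formula L n) (v : 'I_n -> M), range v `<=` A ->
       sat phi (f \o v) <-> sat phi v) ->
    exists g : M -> M, automorphism g /\ forall x, A x -> g x = f x.

Definition monster (kappa : Type) L (M : structure L) : Prop :=
  [/\ small kappa (theory M), saturated kappa M & strongly_homogeneous kappa M].

Definition matroid T (cl : set T -> set T) : Prop :=
  [/\ forall X, X `<=` cl X,
      forall X Y, X `<=` Y -> cl X `<=` cl Y,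
      forall X, cl (cl X) = cl X,
      forall X, cl X = [set a | exists A, [/\ finite_set A, A `<=` X & cl A a]]
    & forall X a c, (cl (X `|` [set c]) `\` cl X) a -> cl (X `|` [set a]) c].

Definition narrow L (M : structure L) (cl : set M -> set M) m (phi : formula L m.+1) : Prop :=
  forall a (b : 'I_m -> M), sat phi (tcons a b) -> cl (range b) a.

Definition definable_matroid L (M : structure L) (cl : set M -> set M) : Prop :=
  forall A, cl A = [set a | exists m (phi : formula L m.+1) (b : 'I_m -> M),
                      [/\ narrow cl phi, range b `<=` A & sat phi (tcons a b)]].

Definition existence (kappa : Type) L (M : structure L) (cl : set M -> set M) : Prop :=
  forall (a : M) (B C : set M), small kappa B -> small kappa C -> ~ cl B a ->
    exists a', same_type B a a' /\ ~ cl (B `|` C) a'.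

Definition existential (kappa : Type) L (M : structure L) (cl : set M -> set M) : Prop :=
  [/\ matroid cl, definable_matroid cl, existence kappa cl & ~ (forall X, cl X = [set: M])].

(* The matroid itself is [mcl] below, the restriction of [em_cl] to [K].  The dimension of
   [K]-definable sets depends on the ambient matroid, so it is part of the data. *)
Record ematroid L (K : structure L) := EMatroid {
  em_kappa : Type;
  em_monster : structure L;
  em_emb : K -> em_monster;
  em_cl : set em_monster -> set em_monster;
  em_elementary : elementary em_emb;
  em_monsterP : monster em_kappa em_monster;
  em_existential : existential em_kappa em_cl }.

Definition restrict_cl T U (e : T -> U) (cl : set U -> set U) : set T -> set T :=
  fun X => e @^-1` cl (e @` X).

Definition mcl L (K : structure L) (E : ematroid K) : set K -> set K :=
  restrict_cl (@em_emb _ _ E) (@em_cl _ _ E).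

(* Dimensions take values in [option nat], where [None] is minus infinity. *)

(* A subtuple of [b] is given by the set [J] of its indices. *)
Definition independent T (cl : set T -> set T) (A : set T) n (b : 'I_n -> T) (J : {set 'I_n}) : Prop :=
  forall j, j \in J -> ~ cl (A `|` [set b k | k in [set k | k \in J /\ k <> j]]) (b j).

Definition maximal_independent T (cl : set T -> set T) (A : set T) n (b : 'I_n -> T) (J : {set 'I_n})
  : Prop := maxset (fun J' => `[< independent cl A b J' >]) J.

(* Dimension of [V], computed over a set [A] over which [V] is definable. *)
Definition dim_over T (cl : set T -> set T) (A : set T) n (V : set ('I_n -> T)) : option nat :=
  if `[< V = set0 >] then None
  else Some (\max_(k < n.+1 | `[< exists2 b, V b &
               exists2 J, maximal_independent cl A b J & #|J| = k >]) k).

(* [edim E X l] : the [K]-definable set [X] has dimension [l], namely that of its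
   interpretation in the monster model.  A relation, since the interpretation goes
   through a defining formula; the value depends neither on it nor on [b]. *)
Definition edim L (K : structure L) (E : ematroid K) n (X : set ('I_n -> K)) (l : option nat) : Prop :=
  exists m (phi : formula L (n + m)) (b : 'I_m -> K),
    X = defset phi b /\
    dim_over (@em_cl _ _ E) (range (@em_emb _ _ E \o b)) (defset phi (@em_emb _ _ E \o b)) = l.

(* The parameters [y] range over the monster model.  Definability of the
   dimension for parameters in [K] only does not imply this: take [acl] on the
   equivalence relation with exactly one class of each finite size, where the
   class of [y] has dimension 0 for every [y] in [K], but dimension 1 for some [y]
   in the monster model.  There [edim] is not a dimension function on [K]. *)
Definition definable_dim L (K : structure L) (E : ematroid K) : Prop :=
  forall n m (phi : formula L (n + m)) (l : nat), l <= n ->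
    exists psi : formula L m, forall y : 'I_m -> em_monster E,
      dim_over (@em_cl _ _ E) (range y) (defset phi y) = Some l <-> sat psi y.

Definition uniformly_definable L I (K : I -> structure L) (E : forall i, ematroid (K i)) : Prop :=
  forall n m (phi : formula L (n + m)) (l : nat), l <= n ->
    exists psi : formula L m, forall i (y : 'I_m -> K i),
      edim (E i) (defset phi y) (Some l) <-> sat psi y.

Definition omax (k l : option nat) : option nat :=
  match k, l with
  | None, _ => l
  | _, None => k
  | Some k, Some l => Some (maxn k l)
  end.

(* Subsets of [K] are identified with sets of 1-tuples. *)
Definition fiber T m (U : set ('I_(m + 1) -> T)) (x : 'I_m -> T) : set ('I_1 -> T) :=
  [set y | U (tcat x y)].

(* A function on definable sets is a function on all sets, whose values
   matter on the definable ones only. *)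
Definition dimension_function L (K : structure L) (d : forall n, set ('I_n -> K) -> option nat) : Prop :=
  [/\ [/\ forall n (S : set ('I_n -> K)), definable S -> d n S = None <-> S = set0,
          forall a : K, d 1 [set fun=> a] = Some 0
        & d 1 [set: 'I_1 -> K] = Some 1],
      forall n (S1 S2 : set ('I_n -> K)), definable S1 -> definable S2 ->
        d n (S1 `|` S2) = omax (d n S1) (d n S2),
      forall n (S : set ('I_n -> K)) (s : 'S_n), definable S ->
        d n [set x \o s | x in S] = d n S
    & forall m (U : set ('I_(m + 1) -> K)) (i : nat), definable U -> i <= 1 ->
        let Ui := [set x | d 1 (fiber U x) = Some i] in
        (forall A, definable_over A U -> definable_over A Ui) /\
        d (m + 1) (U `&` [set u : 'I_(m + 1) -> K | Ui (u \o lshift 1)]) = omap (addn i) (d m Ui)].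

Definition dim_cl L (K : structure L) (d : forall n, set ('I_n -> K) -> option nat) : set K -> set K :=
  fun A => [set b | exists X : set ('I_1 -> K),
                      [/\ definable_over A X, d 1 X = Some 0 & X (fun=> b)]].

Section Ultraproduct.
Variables (L : language) (I : Type) (mu : set_system I).
Context {Fmu : Filter mu}.
Variable K : I -> structure L.

Definition ae_eq : rel {classic (forall i, K i)} :=
  fun f g => `[< \forall i \near mu, f i = g i >].

Lemma ae_eq_refl : reflexive ae_eq.
Proof. by move=> f; apply/asboolP; apply: filterE. Qed.

Lemma ae_eq_sym : symmetric ae_eq.
Proof.
by move=> f g; apply/asboolP/asboolP => h; apply: filterS h => i ->.
Qed.

Lemma ae_eq_trans : transitive ae_eq.
Proof.
move=> g f h /asboolP fg /asboolP gh; apply/asboolP.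
by apply: filterS2 fg gh => i -> ->.
Qed.

Canonical ae_equiv := EquivRel ae_eq ae_eq_refl ae_eq_sym ae_eq_trans.

Definition ucarrier := {eq_quot ae_equiv}.

Definition uclass (f : forall i, K i) : ucarrier := \pi_ucarrier f.

Definition ultraproduct : structure L := @Structure L ucarrier
  (fun f v => uclass (fun i => finterp (fun j => (repr (v j) : forall i, K i) i)))
  (fun r v => \forall i \near mu, rinterp (fun j => (repr (v j) : forall i, K i) i)).

Definition utuple n (x : forall i, 'I_n -> K i) : 'I_n -> ultraproduct :=
  fun j => uclass (fun i => x i j).

Definition uset n (X : forall i, set ('I_n -> K i)) : set ('I_n -> ultraproduct) :=
  [set utuple x | x in [set x | \forall i \near mu, X i (x i)]].

(* The sets [X i] are arbitrary definable sets, not assumed to be defined by the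
   same formula. *)
Definition ultra_dim (E : forall i, ematroid (K i))
    (d : forall n, set ('I_n -> ultraproduct) -> option nat) : Prop :=
  forall n (X : forall i, set ('I_n -> K i)),
    (forall i, definable (X i)) -> definable (uset X) ->
    forall l, d n (uset X) = l <-> \forall i \near mu, edim (E i) (X i) l.

End Ultraproduct.

Arguments ultraproduct {L I} mu {Fmu} K.
Arguments uclass {L I} mu {Fmu K} f.
Arguments utuple {L I} mu {Fmu K n} x.
Arguments uset {L I} mu {Fmu K n} X.
Arguments ultra_dim {L I mu Fmu K} E d.

(* Main.v *)
(** A set definable in the ultraproduct is the ultraproduct of the sets defined
    by the same formula, so by the theorem of Los the dimension axioms are
    inherited from the factors; axiom (Dim 4) holds in a factor because the rank
    of a tuple over a set is additive, and because it can be computed over any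
    small set of parameters, thanks to Existence and homogeneity.

    Given a definable dimension function on [K], call a formula narrow if it
    defines sets of dimension at most 0 in [K].  Narrow formulas define a closure
    operator on every elementary extension [M] of [K].  The matroid axioms are
    statements about narrow formulas, which follow from (Dim 3) and (Dim 4) in
    [K], and saturation of [M] gives Existence.

    The converse fails when [K i] is an infinite set with predicates [P_r],
    [r : nat], all of them empty except [P_i], which holds at a single point [a];
    take [cl_i X = X U {a}].  In an ultraproduct along a nonprincipal ultrafilter
    all the predicates are empty, so that nothing distinguishes the class of [a],
    and it is not algebraic over the empty set. *)
Require Import Defs.
From mathcomp Require Import all_boot perm generic_quotient.
From mathcomp Require Import boolp classical_sets functions cardinality filter.

Set Implicit Arguments.
Unset Strict Implicit.
Unset Printing Implicit Defensive.

Local Open Scope classical_set_scope.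
Local Open Scope card_scope.
Local Open Scope quotient_scope.

(** * Syntax and semantics *)

(** A value of [d] exists because the dimension of a subset of n-space takes finitely many values,
    one of which the ultrafilter selects; it is well defined because two families of sets with the
    same ultraproduct agree almost everywhere. The ultraproduct need not be a monster model, so
    Existence has to be proved in an extension [M], where [d] itself makes no sense. Hence
    narrowness is tested with parameters from [K] only, and the opposite notion, wideness, is
    phrased in [M] as not being covered by any narrow formula; for each narrow formula this is a
    first-order statement, which passes from [K] to [M]. The converse fails because the narrow
    formula that witnesses [a_i] in the closure of [b_i] may change with [i], whereas membership in
    the closure of the ultraproduct demands one formula for almost all [i]. *)

Section Tuples.
Variable T : Type.

Lemma tcons0 n (a : T) (v : 'I_n -> T) : tcons a v ord0 = a.
Proof. by rewrite /tcons unlift_none. Qed.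

Lemma tconsS n (a : T) (v : 'I_n -> T) i : tcons a v (lift ord0 i) = v i.
Proof. by rewrite /tcons liftK. Qed.

Lemma tcatL n m (x : 'I_n -> T) (y : 'I_m -> T) i : tcat x y (lshift m i) = x i.
Proof. by rewrite /tcat (unsplitK (inl i)). Qed.

Lemma tcatR n m (x : 'I_n -> T) (y : 'I_m -> T) j : tcat x y (rshift n j) = y j.
Proof. by rewrite /tcat (unsplitK (inr j)). Qed.

Lemma tcat_split n m (u : 'I_(n + m) -> T) :
  tcat (u \o lshift m) (u \o @rshift n m) = u.
Proof. by apply/funext => k; rewrite /tcat; case: split_ordP => j ->. Qed.

Lemma tcons_split n (u : 'I_n.+1 -> T) : tcons (u ord0) (u \o lift ord0) = u.
Proof. by apply/funext => k; rewrite /tcons; case: unliftP => [j|] ->. Qed.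

Lemma tcat_tcons n m a (x : 'I_n -> T) (y : 'I_m -> T) :
  tcat (tcons a x) y = tcons a (tcat x y).
Proof.
apply/funext => k; rewrite -[k](@splitK n.+1 m); case: (fintype.split k) => [i|j] /=.
  rewrite tcatL; case: (unliftP ord0 i) => [j|] ->.
    rewrite tconsS; have -> : lshift m (lift ord0 j) = lift ord0 (lshift m j).
      exact/val_inj.
    by rewrite tconsS tcatL.
  by rewrite tcons0; have -> : lshift m ord0 = ord0 :> 'I_(n.+1 + m);
    [exact/val_inj | rewrite tcons0].
rewrite tcatR; have -> : rshift n.+1 j = lift ord0 (rshift n j) by exact/val_inj.
by rewrite tconsS tcatR.
Qed.

Lemma tcat0 m (x : 'I_0 -> T) (y : 'I_m -> T) : tcat x y = y.
Proof.
apply/funext => k; have -> : k = @rshift 0 m k by exact/val_inj.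
by rewrite tcatR; congr y; exact/val_inj.
Qed.

(** [1 + m] is convertible to [m.+1], so the same formula can be read as defining a set of 1-tuples
    or be evaluated through [tcons]. *)
Lemma tcat1 m a (y : 'I_m -> T) : tcat (fun _ : 'I_1 => a) y = tcons a y.
Proof.
have -> : (fun=> a) = tcons a (fun _ : 'I_0 => a).
  apply/funext => k; rewrite /tcons; by case: unliftP => // -[].
by rewrite tcat_tcons tcat0.
Qed.

Lemma tuple1 (x : 'I_1 -> T) : x = fun=> x ord0.
Proof. by apply/funext => k; rewrite (ord1 k). Qed.

Lemma range_tcat n m (x : 'I_n -> T) (y : 'I_m -> T) :
  range (tcat x y) = range x `|` range y.
Proof.
apply/seteqP; split=> [_ [k _ <-]|_ [[k _ <-]|[k _ <-]]].
- by rewrite /tcat; case: fintype.split => j; [left|right]; exists j.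
- by exists (lshift m k); rewrite ?tcatL.
- by exists (rshift n k); rewrite ?tcatR.
Qed.

Lemma range_tcons n a (v : 'I_n -> T) : range (tcons a v) = [set a] `|` range v.
Proof.
have := range_tcat (fun _ : 'I_1 => a) v; rewrite tcat1 => ->; congr (_ `|` _).
by apply/seteqP; split => [_ [_ _ <-]|_ ->] //; exists ord0.
Qed.

Lemma range_comp_sub n m (v : 'I_m -> T) (s : 'I_n -> 'I_m) : range (v \o s) `<=` range v.
Proof. by move=> _ [k _ <-]; exists (s k). Qed.

Lemma finite_range n (v : 'I_n -> T) : finite_set (range v).
Proof. exact/finite_image/finite_finset. Qed.

Lemma tcat_lshift n m (x : 'I_n -> T) (y : 'I_m -> T) : tcat x y \o lshift m = x.
Proof. by apply/funext => i /=; rewrite tcatL. Qed.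

Lemma tcat_rshift n m (x : 'I_n -> T) (y : 'I_m -> T) : tcat x y \o @rshift n m = y.
Proof. by apply/funext => i /=; rewrite tcatR. Qed.

Lemma comp_lift0 n (a : T) (v : 'I_n -> T) : tcons a v \o lift ord0 = v.
Proof. by apply/funext => j /=; rewrite tconsS. Qed.

Definition tnil : 'I_0 -> T :=
  fun i => match i with Ordinal _ h => match notF h with end end.

End Tuples.

Lemma comp_tcons T U (f : T -> U) n a (v : 'I_n -> T) : f \o tcons a v = tcons (f a) (f \o v).
Proof. by apply/funext => k; rewrite /= /tcons; case: unlift. Qed.

Lemma comp_tcat T U (f : T -> U) n m (x : 'I_n -> T) (y : 'I_m -> T) :
  f \o tcat x y = tcat (f \o x) (f \o y).
Proof. by apply/funext => k; rewrite /= /tcat; case: fintype.split. Qed.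

Section Syntax.
Variable L : language.

Fixpoint trename n m (s : 'I_n -> 'I_m) (t : term L n) : term L m :=
  match t with
  | Var i => Var L (s i)
  | App f ts => App (fun j => trename s (ts j))
  end.

Definition lift_ren n m (s : 'I_n -> 'I_m) : 'I_n.+1 -> 'I_m.+1 :=
  tcons ord0 (fun i => lift ord0 (s i)).

Fixpoint frename n (p : formula L n) : forall m, ('I_n -> 'I_m) -> formula L m :=
  match p in formula _ n return forall m, ('I_n -> 'I_m) -> formula L m with
  | Bot _ => fun m _ => Bot L m
  | Eq _ s t => fun m r => Eq (trename r s) (trename r t)
  | Rel _ R ts => fun m r => Rel (fun j => trename r (ts j))
  | Imp _ p q => fun m r => Imp (frename p r) (frename q r)
  | All _ p => fun m r => All (frename p (lift_ren r))
  end.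

Definition fNot n (p : formula L n) := Imp p (Bot L n).
Definition fAnd n (p q : formula L n) := fNot (Imp p (fNot q)).
Definition fOr n (p q : formula L n) := Imp (fNot p) q.
Definition fEx n (p : formula L n.+1) := fNot (All (fNot p)).

(** Quantified variables come first and parameters last, as in [defset]; since [n'.+1 + m] reduces
    to [(n' + m).+1], no cast appears. *)
Fixpoint fAlls m n : formula L (n + m) -> formula L m :=
  match n return formula L (n + m) -> formula L m with
  | 0 => fun p => p
  | n'.+1 => fun p => @fAlls m n' (All p)
  end.

Definition fExs m n (p : formula L (n + m)) : formula L m := fNot (fAlls (fNot p)).

Variable M : structure L.

Lemma teval_rename n m (s : 'I_n -> 'I_m) (t : term L n) (v : 'I_m -> M) :
  teval v (trename s t) = teval (v \o s) t.
Proof. by elim: t => [//|f ts IH] /=; congr finterp; apply/funext => j. Qed.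

Lemma sat_rename n (p : formula L n) m (s : 'I_n -> 'I_m) (v : 'I_m -> M) :
  sat (frename p s) v = sat p (v \o s).
Proof.
elim: p m s v => [||||] /= {n}.
- by [].
- by move=> n t u m s v; rewrite !teval_rename.
- by move=> n r ts m s v; congr rinterp; apply/funext => j; rewrite teval_rename.
- by move=> n p IHp q IHq m s v; rewrite IHp IHq.
- move=> n p IH m s v; apply: eq_forall => a; rewrite IH; congr sat.
  apply/funext => k; rewrite /= /lift_ren.
  by case: (unliftP ord0 k) => [j|] ->; rewrite ?tconsS ?tcons0 ?tconsS.
Qed.

Lemma sat_Not n (p : formula L n) (v : 'I_n -> M) : sat (fNot p) v = (~ sat p v).
Proof. by []. Qed.

Lemma sat_Imp n (p q : formula L n) (v : 'I_n -> M) : sat (Imp p q) v = (sat p v -> sat q v).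
Proof. by []. Qed.

Lemma sat_All n (p : formula L n.+1) (v : 'I_n -> M) :
  sat (All p) v = forall a, sat p (tcons a v).
Proof. by []. Qed.

Lemma sat_And n (p q : formula L n) (v : 'I_n -> M) :
  sat (fAnd p q) v = (sat p v /\ sat q v).
Proof.
rewrite /fAnd /=; apply/propext; split=> [h|[hp hq] h]; last exact: (h hp hq).
by apply: contrapT => /not_andP[] hn; apply: h => hp // hq; apply: hn.
Qed.

Lemma sat_Or n (p q : formula L n) (v : 'I_n -> M) :
  sat (fOr p q) v = (sat p v \/ sat q v).
Proof.
rewrite /fOr /=; apply/propext; split=> [h|[hp|hq] //].
by case: (pselect (sat p v)) => hp; [left|right; apply: h].
Qed.

Lemma sat_Ex n (p : formula L n.+1) (v : 'I_n -> M) :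
  sat (fEx p) v = exists a, sat p (tcons a v).
Proof.
rewrite /fEx /=; apply/propext; split=> [h|[a ha] h]; last exact: h ha.
by apply: contrapT => /forallNP hn; apply: h.
Qed.

Lemma sat_Alls m n (p : formula L (n + m)) (v : 'I_m -> M) :
  sat (fAlls p) v = forall x : 'I_n -> M, sat p (tcat x v).
Proof.
elim: n p => [|n IH] p /=.
  apply/propext; split=> [h x|/(_ (@tnil M))]; rewrite ?tcat0 //.
rewrite IH /=; apply/propext; split=> h x => [|a].
  by rewrite -(tcons_split x) tcat_tcons; apply: h.
by rewrite -tcat_tcons.
Qed.

Lemma sat_Exs m n (p : formula L (n + m)) (v : 'I_m -> M) :
  sat (fExs p) v = exists x : 'I_n -> M, sat p (tcat x v).
Proof.
rewrite /fExs sat_Not sat_Alls; apply/propext; split=> [/existsNP[x /contrapT hx]|[x hx] h].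
  by exists x.
exact: h hx.
Qed.

(** Lets a structure be an extension of itself, both for the marked structures and for reading
    [dim_cl] as a closure by narrow formulas. *)
Lemma elementary_id : elementary (@id M).
Proof. by []. Qed.

End Syntax.

Arguments fNot : simpl never.
Arguments fAnd : simpl never.
Arguments fOr : simpl never.
Arguments fEx : simpl never.
Arguments fAlls : simpl never.
Arguments fExs : simpl never.

(** * Invariance of satisfaction under automorphisms *)

Section Automorphisms.
Variables (L : language) (M : structure L) (g : M -> M).
Hypothesis gaut : automorphism g.

Lemma teval_aut n (t : term L n) (v : 'I_n -> M) : teval (g \o v) t = g (teval v t).
Proof.
case: gaut => _ gf _; elim: t => [//|f ts IH] /=.
by rewrite gf; congr finterp; apply/funext => j /=.
Qed.

Lemma sat_aut n (p : formula L n) (v : 'I_n -> M) : sat p (g \o v) = sat p v.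
Proof.
case: (gaut) => -[h gK hK] _ gr; elim: p v => [||||] /= {n}.
- by [].
- move=> n t u v; rewrite !teval_aut; apply/propext; split=> [/(can_inj gK)//|-> //].
- move=> n r ts v; rewrite -(propext (gr r (fun j => teval v (ts j)))).
  by congr rinterp; apply/funext => j; exact: teval_aut.
- by move=> n p IHp q IHq v; rewrite IHp IHq.
- move=> n p IH v; apply/propext; split=> H a.
    by rewrite -IH comp_tcons; apply: H.
  by have := H (h a); rewrite -IH comp_tcons hK.
Qed.

End Automorphisms.

Lemma automorphism_id L (M : structure L) : automorphism (@id M).
Proof. by split=> //; exists id. Qed.

Lemma automorphism_comp L (M : structure L) (g h : M -> M) :
  automorphism g -> automorphism h -> automorphism (g \o h).
Proof.
move=> [gb gf gr] [hb hf hr]; split; first exact: bij_comp.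
- by move=> f v; rewrite -[LHS]/(g (h (finterp v))) hf gf.
- by move=> r v; rewrite -(hr r v) -(gr r (h \o v)).
Qed.

(** * Small sets *)

(** An injection given as a relation needs no values outside [A] and no inhabitant of [U], so it is
    easily assembled from pieces. *)
Lemma card_le_rel T U (A : set T) (B : set U) :
  A #<= B <-> exists R : T -> U -> Prop, (forall x, A x -> exists2 y, B y & R x y) /\
    (forall x x' y, A x -> A x' -> R x y -> R x' y -> x = x').
Proof.
split=> [/card_leP[f]|[R [Rtot Rinj]]].
  exists (fun x y => exists hx : x \in A, val (f (exist _ x hx)) = y); split=> [x Ax|].
    have hx := mem_set Ax; exists (val (f (exist _ x hx))); last by exists hx.
    exact: set_valP.
  move=> x x' y _ _ [hx <-] [hx' /val_inj h].
  have := @inj _ _ _ f (exist _ x' hx') (exist _ x hx).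
  by rewrite !in_setT => /(_ isT isT h) [].
have [->|/set0P[x0 Ax0]] := eqVneq A set0; first exact: card_ge0.
have [y0 By0 _] := Rtot x0 Ax0.
have /choice[f fP] x : exists y, A x -> B y /\ R x y.
  have [/Rtot[y By Rxy]|nAx] := pselect (A x); first by exists y.
  by exists y0.
suff /injfunPex[g] : exists2 f : T -> U, set_fun A B f & set_inj A f.
  exact: inj_card_le g.
exists f => [x /fP[]//|x x' /[!inE] Ax Ax' e].
by apply: (Rinj _ _ (f x)) => //; [case: (fP x)|rewrite e; case: (fP x')].
Qed.

(* A partial bijection is a family of pairs which are disjoint in [T + U]; a
   maximal one exhausts [A] or [B]. *)
Lemma card_le_total T U (A : set T) (B : set U) : A #<= B \/ B #<= A.
Proof.
pose F (p : T * U) : set (T + U) := [set inl p.1; inr p.2].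
have [E [EAB Etriv Emax]] := ex_maximal_disjoint_subcollection F (A `*` B).
have Einj1 x y y' : E (x, y) -> E (x, y') -> y = y'.
  move=> h h'; suff [] : (x, y) = (x, y') by [].
  by apply: Etriv h h' _; exists (inl x); split; left.
have Einj2 x x' y : E (x, y) -> E (x', y) -> x = x'.
  move=> h h'; suff [] : (x, y) = (x', y) by [].
  by apply: Etriv h h' _; exists (inr y); split; right.
have [hA|hA] := pselect (forall x, A x -> exists y, E (x, y)).
  left; apply/card_le_rel; exists (fun x y => E (x, y)); split=> [x /hA[y Exy]|x x' y _ _].
    by exists y => //; have [] := EAB _ Exy.
  exact: Einj2.
have [hB|hB] := pselect (forall y, B y -> exists x, E (x, y)).
  right; apply/card_le_rel; exists (fun y x => E (x, y)); split=> [y /hB[x Exy]|y y' x _ _].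
    by exists x => //; have [] := EAB _ Exy.
  exact: Einj1.
have [x /not_implyP[Ax /forallNP nx]] : exists x, ~ (A x -> exists y, E (x, y)) by exact/existsNP.
have [y /not_implyP[By /forallNP ny]] : exists y, ~ (B y -> exists x, E (x, y)) by exact/existsNP.
exfalso; apply: (Emax (E `|` [set (x, y)])).
- split=> [p|h]; first by left.
  by apply: (nx y); apply: h; right.
- by move=> p [/EAB//|->].
- move=> [x1 y1] [x2 y2] [h1|[-> ->]] [h2|[-> ->]] //.
  + by move=> h; apply: Etriv h1 h2 h.
  + move=> [z [[]/= -> []]] //= []e; last by case: (ny x1); rewrite -e.
    by case: (nx y1); rewrite -e.
  + move=> [z [[]/= -> []]] //= []e; last by case: (ny x2); rewrite e.
    by case: (nx y2); rewrite e.
Qed.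

(* A maximal family of disjoint injective sequences covers [X] up to a finite set. *)
Lemma card_le_double T (X : set T) : infinite_set X -> X `*` [set: bool] #<= X.
Proof.
move=> Xinf.
pose B : set (nat -> T) := [set g | injective g /\ range g `<=` X].
have [D [DB Dtriv Dmax]] := ex_maximal_disjoint_subcollection (fun g : nat -> T => range g) B.
pose X' := \bigcup_(g in D) range g.
have X'X : X' `<=` X by move=> x [g /DB[_ gX] /gX].
have XD : finite_set (X `\` X').
  apply: contrapT => /infiniteP/card_le_rel[R [Rtot Rinj]].
  have /choice[g gP] n : exists y, (X `\` X') y /\ R n y.
    by have [//|y h1 h2] := Rtot n; exists y.
  have ginj : injective g.
    move=> n n' e; apply: (Rinj n n' (g n)) => //; first by case: (gP n).
    by rewrite e; case: (gP n').
  apply: (Dmax (D `|` [set g])).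
  - split=> [h|h]; first by left.
    have Dg : D g by apply: h; right.
    by have [[_ []]] := gP 0; exists g => //; exists 0.
  - by move=> h [/DB//|->]; split=> // _ [n _ <-]; case: (gP n) => -[].
  - move=> g1 g2 [h1|->] [h2|->] //.
    + by move=> h; apply: Dtriv h1 h2 h.
    + move=> [z [hz [n _ e]]]; have [[_ []]] := gP n; rewrite e.
      by exists g1.
    + move=> [z [[n _ e] hz]]; have [[_ []]] := gP n; rewrite e.
      by exists g2.
have X'2 : X' `*` [set: bool] #<= X'.
  apply/card_le_rel; exists (fun (p : T * bool) y => exists g n, [/\ D g, p.1 = g n & y = g (n.*2 + p.2)]).
  split=> [[x b] [/= [g Dg [n _ <-]] _]|[x b] [x' b'] y _ _ /=].
    by exists (g (n.*2 + b)); [exists g => //; exists (n.*2 + b)|exists g, n].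
  move=> [g [n [Dg -> ->]]] [g' [n' [Dg' -> e]]].
  have eg : g = g'.
    by apply: Dtriv => //; exists (g (n.*2 + b)); split; [exists (n.*2 + b)|exists (n'.*2 + b')].
  move: e; rewrite -eg => /(DB _ Dg).1 e.
  have eb : b = b' by have := congr1 odd e; rewrite !oddD !odd_double; case: b b' {e} => -[].
  by move: e; rewrite eb => /eqP; rewrite eqn_add2r => /eqP/double_inj ->.
have X'inf : infinite_set X'.
  move=> X'fin; apply: Xinf; apply: (@sub_finite_set _ _ (X' `|` (X `\` X'))).
    by move=> x Xx; have [|] := pselect (X' x); [left|right].
  by rewrite finite_setU.
have XX' : X #<= X'.
  apply: card_le_trans X'2.
  have /card_le_rel[R [Rtot Rinj]] : X `\` X' #<= X'.
    have [//|h] := card_le_total (X `\` X') X'.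
    by case: X'inf; apply: card_le_finite h XD.
  apply/card_le_rel; exists (fun x p => (X' x /\ p = (x, true)) \/ [/\ ~ X' x, R x p.1 & p.2 = false]).
  split=> [x Xx|x x' [y b] Xx Xx'].
    have [X'x|nX'x] := pselect (X' x); first by exists (x, true); [|left].
    by have [//|y ? ?] := Rtot x; exists (y, false); [|right].
  move=> [[_ [yx bt]]|[nx Rx /= bf]] [[_ [yx' bt']]|[nx' Rx' /= bf']].
  - by rewrite -yx.
  - by rewrite bt in bf'.
  - by rewrite bt' in bf.
  - exact: Rinj Rx Rx'.
apply: (card_le_trans _ (subset_card_le X'X)); apply: card_le_trans X'2.
move: XX' => /card_le_rel[R [Rtot Rinj]].
apply/card_le_rel; exists (fun p q => R p.1 q.1 /\ p.2 = q.2); split=> [[x b] [/= Xx _]|].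
  by have [y ? ?] := Rtot x Xx; exists (y, b).
move=> [x b] [x' b'] [y c] [/= Xx _] [/= Xx' _] [Rx ->] [Rx' ->].
by rewrite (Rinj x x' y).
Qed.

(** [A] goes into one of the two copies of [X] provided by [card_le_double], the rest of [B] into
    the other. *)
Lemma card_le_setU T U (A B : set T) (X : set U) :
  infinite_set X -> A #<= X -> B #<= X -> A `|` B #<= X.
Proof.
move=> Xinf /card_le_rel[R [Rtot Rinj]] /card_le_rel[S [Stot Sinj]].
apply: card_le_trans (card_le_double Xinf); apply/card_le_rel.
exists (fun x p => (A x /\ R x p.1 /\ p.2 = true) \/ (~ A x /\ S x p.1 /\ p.2 = false)).
split=> [x ABx|x x' [y b] hx hx'].
  have [Ax|nAx] := pselect (A x).
    by have [y ? ?] := Rtot x Ax; exists (y, true) => //; left.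
  by case: ABx => // Bx; have [y ? ?] := Stot x Bx; exists (y, false) => //; right.
move=> [[Ax [/= Rx ->]]|[nAx [/= Sx ->]]] [[Ax' [/= Rx' //]]|[nAx' [/= Sx' //]]] _.
- exact: Rinj Rx Rx'.
- by case: hx => // Bx; case: hx' => // Bx'; apply: Sinj Sx Sx'.
Qed.

Section Small.
Variable kappa : Type.
Hypothesis kinf : infinite_set [set: kappa].

Lemma smallP T (A : set T) : ~ ([set: kappa] #<= A) -> small kappa A.
Proof. by move=> h; split=> //; have [|] := card_le_total A [set: kappa]. Qed.

Lemma small_finite T (A : set T) : finite_set A -> small kappa A.
Proof. by move=> Afin; apply: smallP => /card_le_finite /(_ Afin). Qed.

Lemma small_setU T (A B : set T) : small kappa A -> small kappa B -> small kappa (A `|` B).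
Proof.
wlog AB : A B / A #<= B.
  move=> H sA sB; have [h|h] := card_le_total A B; first exact: H.
  by rewrite setUC; apply: H.
move=> sA sB; have [Bfin|Binf] := pselect (finite_set B).
  by apply: small_finite; rewrite finite_setU; split=> //; apply: card_le_finite AB Bfin.
apply: smallP => h; apply: sB.2; apply: card_le_trans h _.
exact: card_le_setU.
Qed.

Lemma small_image T U (f : T -> U) (A : set T) : small kappa A -> small kappa (f @` A).
Proof.
by move=> [_ nA]; apply: smallP => h; apply: nA; apply: card_le_trans h (card_image_le _ _).
Qed.

End Small.

(** * Dimension in a matroid *)

Section MatroidTheory.
Variables (T : Type) (cl : set T -> set T).
Hypothesis clM : matroid cl.

Lemma cl_ext X : X `<=` cl X. Proof. by case: clM. Qed.
Lemma cl_mono X Y : X `<=` Y -> cl X `<=` cl Y. Proof. by case: clM => _ + _ _ _; apply. Qed.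
Lemma cl_sub X Y : X `<=` cl Y -> cl X `<=` cl Y.
Proof. by case: clM => _ _ cl_idem _ _ XY; rewrite -[cl Y]cl_idem; apply: cl_mono. Qed.
Lemma cl_exchange X a c : cl (X `|` [set c]) a -> ~ cl X a -> cl (X `|` [set a]) c.
Proof. by case: clM => _ _ _ _ exch h1 h2; apply: exch. Qed.

Definition img n (b : 'I_n -> T) (J : {set 'I_n}) : set T := b @` [set` J].

Lemma img_sub n (b : 'I_n -> T) (J J' : {set 'I_n}) : J \subset J' -> img b J `<=` img b J'.
Proof. by move=> /fintype.subsetP JJ'; apply: image_subset => j /JJ'. Qed.

Lemma img_imset n m (f : 'I_m -> 'I_n) (b : 'I_n -> T) (J : {set 'I_m}) : img b (f @: J) = img (b \o f) J.
Proof.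
apply/seteqP; split=> [_ [_ /imsetP[j Jj ->] <-]|_ [j Jj <-]]; first by exists j.
by exists (f j) => //; apply: imset_f.
Qed.

Lemma independentE A n (b : 'I_n -> T) J :
  independent cl A b J <-> forall j, j \in J -> ~ cl (A `|` img b (J :\ j)) (b j).
Proof.
suff e j : [set k | k \in J /\ k <> j] = [set` J :\ j].
  by split=> h j Jj; have := h j Jj; rewrite /img e.
apply/seteqP; split=> k /=; rewrite !inE; first by move=> [-> /eqP->].
by move=> /andP[/eqP].
Qed.

Lemma independent_sub A A' n (b : 'I_n -> T) (J J' : {set 'I_n}) : A' `<=` A -> J' \subset J ->
  independent cl A b J -> independent cl A' b J'.
Proof.
move=> AA' JJ'; rewrite !independentE => h j J'j hj.
apply: (h j); first exact: (fintype.subsetP JJ').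
by apply: cl_mono hj; apply: setUSS => //; apply/img_sub/finset.setSD.
Qed.

Lemma independent0 A n (b : 'I_n -> T) : independent cl A b finset.set0.
Proof. by move=> j; rewrite inE. Qed.

(** If adding [b j] put some earlier [b i] in the closure of the others, exchange would put [b j] in
    the closure of [J]. *)
Lemma independentU1 A n (b : 'I_n -> T) J j : independent cl A b J ->
  ~ cl (A `|` img b J) (b j) -> independent cl A b (j |: J).
Proof.
rewrite !independentE => h nj i; rewrite !inE => /orP[/eqP->|Ji].
  apply: contra_not nj; apply: cl_mono; apply: setUS; apply: img_sub.
  by apply/fintype.subsetP => k; rewrite !inE => /andP[/negPf->].
have ij : i != j.
  by apply: contra_notN nj => /eqP <-; apply: cl_ext; right; exists i.
have -> : (j |: J) :\ i = j |: (J :\ i).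
  apply/setP => k; rewrite !inE; case: (eqVneq k j) => [->|//].
  by rewrite eq_sym ij.
have -> : img b (j |: J :\ i) = img b (J :\ i) `|` [set b j].
  apply/seteqP; split=> [_ [k + <-]|_ [[k Jk <-]|->]]; rewrite /= ?inE.
  - by case/orP => [/eqP->|hk]; [right|left; exists k; rewrite //= !inE].
  - by exists k => //=; rewrite inE Jk orbT.
  - by exists j => //=; rewrite !inE eqxx.
rewrite setUA => /cl_exchange /(_ (h i Ji)) hj; apply: nj; apply: cl_mono hj.
rewrite -setUA; apply: setUS => _ [[k + <-]|->]; last by exists i.
by rewrite /= !inE => /andP[_ Jk]; exists k.
Qed.

Lemma independent_comp A n m (f : 'I_m -> 'I_n) (b : 'I_n -> T) (J : {set 'I_m}) : injective f ->
  independent cl A (b \o f) J <-> independent cl A b (f @: J).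
Proof.
move=> finj; rewrite !independentE.
have e j : j \in J -> f @: J :\ f j = f @: (J :\ j).
  move=> Jj; apply/setP => k; rewrite !inE; apply/andP/imsetP.
    by move=> [kj /imsetP[i Ji e]]; exists i; rewrite // !inE Ji andbT; apply: contraNneq kj => <-; rewrite e.
  by move=> [i]; rewrite !inE => /andP[ij Ji] ->; rewrite (inj_eq finj) imset_f.
split=> h.
  by move=> _ /imsetP[j Jj ->]; rewrite e // img_imset; apply: h.
by move=> j Jj; rewrite -img_imset -e //; apply: h; apply: imset_f.
Qed.

Lemma maximal_extension A n (b : 'I_n -> T) J : independent cl A b J ->
  exists2 J', maximal_independent cl A b J' & J \subset J'.
Proof.
move=> /asboolP iJ.
have [J' ? ?] := @maxset_exists _ (fun J => `[< independent cl A b J >]) J iJ.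
by exists J'.
Qed.

Lemma maximal_spans A n (b : 'I_n -> T) J : maximal_independent cl A b J ->
  A `|` range b `<=` cl (A `|` img b J).
Proof.
move=> /maxsetP[/asboolP indJ maxJ] x [Ax|[i _ <-]]; first by apply: cl_ext; left.
apply: contrapT => ni; have /asboolP/maxJ e := independentU1 indJ ni.
apply: ni; apply: cl_ext; right; exists i => //=.
by rewrite -e ?finset.subsetUr // !inE eqxx.
Qed.

(** [dim_over] is a maximum over maximal independent index sets. As every independent set extends to
    a maximal one, lower bounds may use any independent set, which is easier to transport. *)
Definition dim_ge A n (V : set ('I_n -> T)) k :=
  exists2 b, V b & exists2 J, independent cl A b J & k <= #|J|.

Lemma dim_ge_le A n (V : set ('I_n -> T)) k l : l <= k -> dim_ge A V k -> dim_ge A V l.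
Proof. by move=> lk [b Vb [J iJ kJ]]; exists b => //; exists J => //; apply: leq_trans kJ. Qed.

Lemma dim_ge0 A n (V : set ('I_n -> T)) : dim_ge A V 0 <-> V !=set0.
Proof.
split=> [[b Vb _]|[b Vb]]; exists b => //.
by exists finset.set0 => //; apply: independent0.
Qed.

Lemma dim_overN A n (V : set ('I_n -> T)) : dim_over cl A V = None <-> V = set0.
Proof. by rewrite /dim_over; case: asboolP. Qed.

Lemma dim_overP A n (V : set ('I_n -> T)) l :
  dim_over cl A V = Some l <-> dim_ge A V l /\ ~ dim_ge A V l.+1.
Proof.
rewrite /dim_over; case: asboolP => [->|/eqP/set0P V0].
  by split=> // -[[]].
set r := \max_(_ < _ | _) _.
have le k : dim_ge A V k -> k <= r.
  move=> [b Vb [J indJ kJ]]; have [J' maxJ' JJ'] := maximal_extension indJ.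
  have J'n : #|J'| < n.+1 by rewrite ltnS -[X in _ <= X]card_ord max_card.
  apply: leq_trans (leq_trans kJ (subset_leq_card JJ')) _.
  apply: (@leq_bigmax_cond _ (fun k : 'I_n.+1 => _) (fun k => nat_of_ord k) (Ordinal J'n)).
  by apply/asboolP; exists b => //; exists J'.
have ge : dim_ge A V r.
  have [b Vb] := V0; have [J maxJ _] := maximal_extension (@independent0 A n b).
  have Jn : #|J| < n.+1 by rewrite ltnS -[X in _ <= X]card_ord max_card.
  have [|k /asboolP[c Vc [J' /maxsetP[/asboolP iJ' _] eJ']] ek] :=
    @eq_bigmax_cond 'I_n.+1 (fun k => `[< exists2 b, V b &
      exists2 J, maximal_independent cl A b J & #|J| = k >]) (fun k => nat_of_ord k).
    apply/card_gt0P; exists (Ordinal Jn); apply/asboolP.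
    by exists b => //; exists J.
  exists c => //; exists J' => //; rewrite eJ' /r.
  by rewrite -ek leqnn.
split=> [[<-]|[h1 h2]]; last first.
  congr Some; apply/eqP; rewrite eqn_leq le // andbT leqNgt; apply/negP => lr.
  by apply: h2; apply: dim_ge_le ge.
by split=> // /le; rewrite ltnn.
Qed.

Lemma dim_over_eq A A' n (V V' : set ('I_n -> T)) :
  (forall k, dim_ge A V k <-> dim_ge A' V' k) -> dim_over cl A V = dim_over cl A' V'.
Proof.
move=> h; case e: (dim_over cl A' V') => [l|].
  by apply/dim_overP; rewrite !h; apply/dim_overP.
apply/dim_overN; move/dim_overN: e => e; apply: contrapT => /eqP/set0P.
by move=> /(dim_ge0 A)/h/dim_ge0; rewrite e => -[].
Qed.

Lemma dim_over_le A n (V : set ('I_n -> T)) l : dim_over cl A V = Some l -> l <= n.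
Proof.
move=> /dim_overP[[b _ [J _ lJ]] _]; apply: leq_trans lJ _.
by rewrite -[X in _ <= X]card_ord max_card.
Qed.

Lemma independent_last A m (u : 'I_(m + 1) -> T) J :
  independent cl A (u \o lshift 1) J ->
  ~ cl (A `|` range (u \o lshift 1)) (u (rshift m ord0)) ->
  exists2 J', independent cl A u J' & #|J'| = #|J|.+1.
Proof.
move=> /independent_comp -/(_ (@lshift_inj _ _)) iJ nu.
exists (rshift m ord0 |: lshift 1 @: J).
  apply: independentU1 => //; apply: contra_not nu; apply: cl_mono.
  by rewrite img_imset; apply: setUS; apply: image_subset.
rewrite cardsU1 card_imset; last exact: lshift_inj.
rewrite (_ : _ \notin _) //; apply/imsetP => -[i _ e].
by have := @eq_lrshift m 1 i ord0; rewrite -e eqxx.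
Qed.

(** Dropping the last index costs at most one. When the last entry lies in the closure of the others
    and its index is in [J], the remaining indices [J0] cannot be maximal: they would span the last
    entry, against the independence of [J]. A maximal extension of [J0] then makes up for the
    loss. *)
Lemma independent_init A m (u : 'I_(m + 1) -> T) J : independent cl A u J ->
  exists2 J', independent cl A (u \o lshift 1) J' &
    #|J| <= #|J'|.+1 /\ (cl (A `|` range (u \o lshift 1)) (u (rshift m ord0)) -> #|J| <= #|J'|).
Proof.
move=> iJ; pose J0 := [set i | lshift 1 i \in J]%SET.
have J0J : lshift 1 @: J0 \subset J.
  by apply/fintype.subsetP => _ /imsetP[i + ->]; rewrite inE.
have iJ0 : independent cl A (u \o lshift 1) J0.
  by apply/independent_comp; [exact: lshift_inj|apply: independent_sub iJ].
have JJ0 : J \subset rshift m ord0 |: lshift 1 @: J0.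
  apply/fintype.subsetP => k; rewrite !inE; case: (split_ordP k) => j ->.
    by move=> hj; rewrite imset_f ?orbT // inE.
  by rewrite (ord1 j) eqxx.
have cJ0 : #|lshift 1 @: J0| = #|J0| by rewrite card_imset //; exact: lshift_inj.
have [J' maxJ' J0J'] := maximal_extension iJ0.
have J0J'c := subset_leq_card J0J'.
exists J'; first by case/maxsetP: maxJ' => /asboolP.
split.
  apply: leq_trans (subset_leq_card JJ0) _.
  by rewrite cardsU1 cJ0 -[#|J'|.+1]add1n leq_add // leq_b1.
move=> lastcl; have [Jl|nJl] := boolP (rshift m ord0 \in J); last first.
  apply: leq_trans J0J'c; rewrite -cJ0; apply: subset_leq_card.
  apply/fintype.subsetP => k Jk; have := fintype.subsetP JJ0 k Jk.
  by rewrite !inE => /orP[/eqP e|//]; rewrite -e Jk in nJl.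
apply: leq_trans (_ : #|J0|.+1 <= _).
  apply: leq_trans (subset_leq_card JJ0) _.
  by rewrite cardsU1 cJ0 -[#|J0|.+1]add1n leq_add // leq_b1.
rewrite ltn_neqAle J0J'c andbT; apply/negP => /eqP e.
have {e} e : J0 = J' by apply/eqP; rewrite eqEcard J0J' e leqnn.
move/independentE: iJ => /(_ _ Jl); apply.
apply: cl_mono (cl_sub (maximal_spans maxJ') lastcl).
rewrite -e -img_imset; apply: setUS; apply: img_sub.
rewrite finset.subsetD1 J0J /=; apply/imsetP => -[i _ e'].
by have := @eq_lrshift m 1 i ord0; rewrite -e' eqxx.
Qed.

Lemma dim_over1 A (V : set ('I_1 -> T)) : dim_ge A V 1 <-> exists2 y, V y & ~ cl A (y ord0).
Proof.
have im0 (y : 'I_1 -> T) (J : {set 'I_1}) : J \subset finset.set0 -> A `|` img y J = A.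
  by rewrite finset.subset0 => /eqP ->; apply/setUidPl => _ [k + <-]; rewrite /= inE.
split=> -[y Vy].
  move=> [J /independentE iJ /card_gt0P[j Jj]]; exists y => //.
  have := iJ j Jj; rewrite (ord1 j) im0 //.
  by apply/fintype.subsetP => k; rewrite !inE (ord1 k) eqxx.
move=> ny; exists y => //; exists [set ord0]%SET; last by rewrite cards1.
have := @independentU1 A 1 y finset.set0 ord0 (@independent0 A 1 y).
by rewrite finset.setU0 im0 //; apply.
Qed.

(** The fiber over [x] is measured over [A] and [x] together, which is the set the last coordinate
    must avoid for the rank to grow. [independent_init] bounds the rank from above,
    [independent_last] from below. *)
Lemma dim_over_fiber A m (W : set ('I_(m + 1) -> T)) (B : set ('I_m -> T)) i : i <= 1 ->
  (forall u, W u -> B (u \o lshift 1)) ->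
  (forall x, B x -> dim_over cl (A `|` range x) (fiber W x) = Some i) ->
  dim_over cl A W = omap (addn i) (dim_over cl A B).
Proof.
move=> i1 WB dB.
have tc (x : 'I_m -> T) (y : 'I_1 -> T) : tcat x y \o lshift 1 = x /\ tcat x y (rshift m ord0) = y ord0.
  by split; [apply/funext => k /=; rewrite tcatL|rewrite tcatR].
have WBge k : dim_ge A W (i + k) <-> dim_ge A B k.
  split=> [[u Wu [J iJ ikJ]]|[x Bx [J iJ kJ]]].
    have [J' iJ' [J'1 J'2]] := independent_init iJ.
    exists (u \o lshift 1); first exact: WB.
    exists J' => //; have := dB _ (WB _ Wu).
    case: i i1 ikJ {dB} => [_ kJ|[_ kJ _|//]]; last by rewrite -ltnS; apply: leq_trans J'1.
    move=> /dim_overP[_]; rewrite dim_over1 => /forall2NP ncl.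
    apply: leq_trans kJ (J'2 _); have [|/contrapT] := ncl (u \o @rshift m 1).
      by rewrite /fiber /= tcat_split.
    by [].
  have /dim_overP[] := dB x Bx.
  case: i i1 {dB} => [_ /dim_ge0[y Wy] _|[_|//]].
    exists (tcat x y) => //; exists (lshift 1 @: J).
      by apply/independent_comp; [exact: lshift_inj|rewrite (tc x y).1].
    by rewrite card_imset //; exact: lshift_inj.
  move=> /dim_over1[y Wy ny] _; exists (tcat x y) => //.
  have [||J' iJ' eJ'] := @independent_last A m (tcat x y) J.
  - by rewrite (tc x y).1.
  - by rewrite (tc x y).1 (tc x y).2.
  - by exists J'; rewrite // eJ' add1n ltnS.
case e: (dim_over cl A B) => [l|] /=.
  by apply/dim_overP; rewrite -addnS !WBge; apply/dim_overP.
move/dim_overN: e => e; apply/dim_overN/seteqP; split=> // u /WB.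
by rewrite e.
Qed.

End MatroidTheory.

(** * Dimension in a monster model *)

Fixpoint impl_depth L n (p : formula L n) : nat :=
  if p is Imp _ _ q then (impl_depth q).+1 else 0.

(** The tautologies [f n] are told apart by [impl_depth]. A monster model has a small theory, so
    this forces [kappa] to be infinite, as the arithmetic of small sets requires. *)
Lemma theory_infinite L (M : structure L) : infinite_set (theory M).
Proof.
pose f n := iter n (Imp (Bot L 0)) (Imp (Bot L 0) (Bot L 0)).
have fdepth n : impl_depth (f n) = n.+1 by elim: n => //= n ->.
apply/infiniteP/card_le_rel; exists (fun n p => p = f n); split=> [n _|n n' p _ _ -> e].
  by exists (f n) => // v; rewrite /f; case: n => [|n] /= [].
by have := congr1 (@impl_depth L 0) e; rewrite !fdepth => -[].
Qed.

Lemma monster_infinite kappa L (M : structure L) : monster kappa M -> infinite_set [set: kappa].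
Proof. by move=> [[le _] _ _] /(card_le_finite le); apply: theory_infinite. Qed.

(** All occurrences of [c] are merged into one variable, leaving parameters in [B]. The last clause
    serves homogeneity: a map fixing [B] pointwise acts on the tuple only through its value at
    [c]. *)
Lemma split_params T (B : set T) c n (v : 'I_n -> T) : range v `<=` B `|` [set c] ->
  exists m (b : 'I_m -> T) (s : 'I_n -> 'I_m.+1),
    [/\ range b `<=` B, v = tcons c b \o s &
        ~ B c -> forall f : T -> T, (forall x, B x -> f x = x) -> f \o v = tcons (f c) b \o s].
Proof.
move=> vBc; pose P := [set i | `[< v i <> c >]]%SET.
have bB : range (v \o @enum_val _ (mem P)) `<=` B.
  move=> _ [k _ <-] /=; have := enum_valP k; rewrite inE => /asboolP nk.
  by have [||/nk] := vBc (v (enum_val k)); first by exists (enum_val k).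
pose s (i : 'I_n) := if [pick k : 'I_#|P| | enum_val k == i] is Some k then lift ord0 k else ord0.
have sP i : (v i = c /\ s i = ord0) \/ exists2 k, s i = lift ord0 k & v i = v (enum_val k).
  rewrite /s; case: pickP => [k /eqP <-|h]; first by right; exists k.
  left; split=> //; apply: contrapT => nc.
  have iP : i \in P by rewrite inE; apply/asboolP.
  by have := h (enum_rank_in iP i); rewrite enum_rankK_in // eqxx.
exists #|P|, (v \o @enum_val _ (mem P)), s; split=> //.
  apply/funext => i /=.
  by have [[-> ->]|[k -> ->]] := sP i; rewrite ?tcons0 ?tconsS.
move=> nBc f fB; apply/funext => i /=.
have [[-> ->]|[k -> ->]] := sP i; rewrite ?tcons0 ?tconsS //=.
by apply: fB; apply: bB; exists k.
Qed.

Section Monster.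
Variables (kappa : Type) (L : language) (M : structure L) (cl : set M -> set M).
Hypothesis mM : monster kappa M.
Hypothesis exM : existential kappa cl.

Let kinf := monster_infinite mM.
Let clM : matroid cl. Proof. by case: exM. Qed.

(** A narrow formula has no parameters of its own, so an automorphism carries a witness for [a] to a
    witness for [g a]. *)
Lemma cl_aut g A a : automorphism g -> cl A a -> cl (g @` A) (g a).
Proof.
case: exM => _ dcl _ _ gaut; rewrite [cl A]dcl [cl (_ @` _)]dcl => -[m [p [b [np bA pab]]]].
exists m, p, (g \o b); split=> //.
  by move=> _ [k _ <-]; exists (b k) => //; apply: bA; exists k.
by rewrite -comp_tcons sat_aut.
Qed.

Lemma independent_aut g A n (b : 'I_n -> M) J : automorphism g -> (forall x, A x -> g x = x) ->
  independent cl A b J -> independent cl A (g \o b) J.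
Proof.
move=> gaut gA iJ j Jj h; apply: (iJ j Jj).
have [gb gf gr] := gaut; have [h' gK hK] := gb.
have h'aut : automorphism h'.
  split; first by exists g.
  - by move=> f v; apply: (can_inj gK); rewrite hK gf; congr finterp; apply/funext => k /=; rewrite hK.
  - by move=> r v; rewrite -gr (_ : g \o (h' \o v) = v) //; apply/funext => k /=; rewrite hK.
have := cl_aut h'aut h; rewrite /= gK; apply: (cl_mono clM).
move=> _ [x [Ax|[k Jk <-]] <-] /=; first by left; rewrite -{1}(gA x) // gK.
by right; exists k => //=; rewrite gK.
Qed.

Lemma homogeneous_move (B : set M) a a' : small kappa B -> ~ B a -> same_type B a a' ->
  exists g : M -> M, [/\ automorphism g, forall x, B x -> g x = x & g a = a'].
Proof.
move=> sB nBa st; case: mM => _ _ sh.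
(* This map moves only [a]; it is elementary on [B] and [a] together precisely because [a] and [a']
   have the same type over [B]. *)
pose f x := if `[< x = a >] then a' else x.
have fa : f a = a' by rewrite /f asboolT.
have fB x : B x -> f x = x.
  by rewrite /f; case: asboolP => // -> /nBa.
have [||g [gaut gf]] := sh (B `|` [set a]) f.
- by apply: small_setU => //; apply: small_finite.
- move=> n p v rv; have [m [b [s [bB ev ef0]]]] := split_params rv; have ef := ef0 nBa f fB.
  by rewrite ef fa ev -!sat_rename; apply: iff_sym; apply: st.
exists g; split=> // [x Bx|]; last by rewrite gf ?fa //; right.
by rewrite gf ?fB //; left.
Qed.

(* The elements of the tuple are moved one at a time: Existence finds the new
   position, and homogeneity an automorphism leading there. *)
Lemma independent_extend (A C : set M) n (b : 'I_n -> M) (J : {set 'I_n}) :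
  small kappa A -> small kappa C -> independent cl A b J ->
  exists g, [/\ automorphism g, forall x, A x -> g x = x & independent cl (A `|` C) (g \o b) J].
Proof.
move=> sA sC; have [k kJ] := ubnP #|J|; elim: k J kJ => // k IH J kJ iJ.
have [->|[j Jj]] := set_0Vmem J.
  by exists id; split=> //; [exact: automorphism_id|apply: independent0].
have J0J : J :\ j \subset J by apply: subD1set.
have [||g0 [g0aut g0A iJ0]] := IH (J :\ j).
- by move: kJ; rewrite (cardsD1 j) Jj.
- exact: (independent_sub clM _ J0J iJ).
have nj : ~ cl (A `|` img (g0 \o b) (J :\ j)) ((g0 \o b) j).
  by have /independentE := independent_aut g0aut g0A iJ; apply.
have [_ _ ex _] := exM.
have sB : small kappa (A `|` img (g0 \o b) (J :\ j)).
  apply: small_setU => //; apply: small_finite => //.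
  exact/finite_image/finite_finset.
have [a' [st na']] := ex _ _ C sB sC nj.
have nB : ~ (A `|` img (g0 \o b) (J :\ j)) ((g0 \o b) j).
  by move=> h; apply: nj; apply: (cl_ext clM).
have [h [haut hB ha]] := homogeneous_move sB nB st.
have eb : img (h \o (g0 \o b)) (J :\ j) = img (g0 \o b) (J :\ j).
  apply/seteqP; split=> _ [i Ji <-]; exists i => //=; first by rewrite hB //; right; exists i.
  by rewrite hB //; right; exists i.
exists (h \o g0); split; first exact: automorphism_comp.
  by move=> x Ax; rewrite /= g0A // hB //; left.
rewrite -(finset.setD1K Jj); apply: (independentU1 clM).
  move=> i Ji; have := iJ0 i Ji; rewrite /= hB; last by right; exists i.
  apply: contra_not; apply: (cl_mono clM); apply: setUS => _ [l [Jl li] <-].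
  by exists l => //=; rewrite hB //; right; exists l.
rewrite -/(img _ _) -[(h \o g0) \o b]/(h \o (g0 \o b)) eb.
rewrite -[(h \o _) j]/(h ((g0 \o b) j)) ha.
by rewrite setUAC.
Qed.

(** Enlarging the base can only destroy independence. Conversely, an independent tuple of [V] is
    moved over [A] to one independent over the larger base, and invariance keeps it in [V]. *)
Lemma dim_ge_base (A C : set M) n (V : set ('I_n -> M)) k : small kappa A -> small kappa C ->
  (forall g v, automorphism g -> (forall x, A x -> g x = x) -> V v -> V (g \o v)) ->
  dim_ge cl A V k <-> dim_ge cl (A `|` C) V k.
Proof.
move=> sA sC Vinv; split=> -[b Vb [J iJ kJ]].
  have [g [gaut gA giJ]] := independent_extend sA sC iJ.
  by exists (g \o b); [exact: Vinv|exists J].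
by exists b => //; exists J => //; apply: independent_sub iJ => //; left.
Qed.

Lemma dim_over_defset_base n m (p : formula L (n + m)) (b : 'I_m -> M) (C : set M) :
  small kappa C ->
  dim_over cl (range b) (defset p b) = dim_over cl (range b `|` C) (defset p b).
Proof.
move=> sC; apply: dim_over_eq => k; apply: dim_ge_base => //.
  by apply: small_finite => //; apply: finite_range.
move=> g v gaut gA; rewrite /defset /= -(sat_aut gaut) comp_tcat.
by rewrite (_ : g \o b = b) //; apply/funext => j /=; apply: gA; exists j.
Qed.

(** Both sides equal the dimension over the union of the two parameter sets. *)
Lemma dim_over_defset n m (p : formula L (n + m)) (b : 'I_m -> M)
    m' (p' : formula L (n + m')) (b' : 'I_m' -> M) : defset p b = defset p' b' ->
  dim_over cl (range b) (defset p b) = dim_over cl (range b') (defset p' b').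
Proof.
have sr k (c : 'I_k -> M) : small kappa (range c).
  by apply: small_finite => //; apply: finite_range.
move=> e; rewrite (@dim_over_defset_base _ _ p b _ (sr _ b')) e setUC.
by rewrite -(@dim_over_defset_base _ _ p' b' _ (sr _ b)).
Qed.

End Monster.

(** * Elementary embeddings and the dimension of sets definable in [K] *)

Section Elementary.
Variables (L : language) (K M : structure L) (e : K -> M).
Hypothesis eel : elementary e.

Lemma sat_elementary n (p : formula L n) (v : 'I_n -> K) : sat p (e \o v) = sat p v.
Proof. exact/propext/eel. Qed.

(** Inclusion is a first-order condition on the two parameter tuples; [s] and [s'] place them side
    by side in one formula. *)
Lemma defset_elementary n m (p : formula L (n + m)) (b : 'I_m -> K)
    m' (p' : formula L (n + m')) (b' : 'I_m' -> K) :
  defset p b `<=` defset p' b' -> defset p (e \o b) `<=` defset p' (e \o b').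
Proof.
pose s : 'I_(n + m) -> 'I_(n + (m + m')) := tcat (lshift (m + m')) (fun j => rshift n (lshift m' j)).
pose s' : 'I_(n + m') -> 'I_(n + (m + m')) := tcat (lshift (m + m')) (fun j => rshift n (rshift m j)).
pose q := fAlls (Imp (frename p s) (frename p' s')).
have qE (N : structure L) (c : 'I_m -> N) (c' : 'I_m' -> N) :
    sat q (tcat c c') = (defset p c `<=` defset p' c').
  rewrite /q sat_Alls; apply: eq_forall => x /=; rewrite !sat_rename /s /s' !comp_tcat.
  have -> : tcat x (tcat c c') \o lshift (m + m') = x by apply/funext => i /=; rewrite tcatL.
  have -> : tcat x (tcat c c') \o (fun j => rshift n (lshift m' j)) = c.
    by apply/funext => i /=; rewrite tcatR tcatL.
  have -> : tcat x (tcat c c') \o (fun j => rshift n (rshift m j)) = c'.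
    by apply/funext => i /=; rewrite !tcatR.
  by [].
by rewrite -!qE -comp_tcat sat_elementary.
Qed.

Lemma defset_elementary_eq n m (p : formula L (n + m)) (b : 'I_m -> K)
    m' (p' : formula L (n + m')) (b' : 'I_m' -> K) :
  defset p b = defset p' b' -> defset p (e \o b) = defset p' (e \o b').
Proof. by move=> h; apply/seteqP; split; apply: defset_elementary; rewrite h. Qed.

End Elementary.

Section Edim.
Variables (L : language) (K : structure L) (E : ematroid K).
Local Notation e := (@em_emb _ _ E).
Local Notation cl := (@em_cl _ _ E).

Lemma ematroid_matroid : matroid cl.
Proof. by case: (em_existential E). Qed.

Lemma edim_defset n m (p : formula L (n + m)) (b : 'I_m -> K) l :
  edim E (defset p b) l <-> dim_over cl (range (e \o b)) (defset p (e \o b)) = l.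
Proof.
split=> [[m' [p' [b' [h <-]]]]|h]; last by exists m, p, b.
apply: (dim_over_defset (em_monsterP E) (em_existential E)).
exact: (defset_elementary_eq (em_elementary E)).
Qed.

(** The theorem of Los chooses an element in every factor. On an empty structure every operator is
    trivial, so the monster model has a point, and elementarity gives one in [K]. *)
Lemma ematroid_inhabited : exists a : K, True.
Proof.
have [_ _ _ ntriv] := em_existential E.
have [a _] : exists a : em_monster E, True.
  apply: contrapT => /forallNP h; apply: ntriv => X; apply/seteqP; split=> // a _.
  by case: (h a).
have := sat_elementary (em_elementary E) (All (Bot L 1)) (@tnil K).
move=> /= eq; apply: contrapT => /forallNP h.
have : em_monster E -> False by rewrite eq => x; apply: (h x).
exact.
Qed.

End Edim.

(** * The dimension function of an existential matroid *)

Section DefinableSets.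
Variable L : language.

Definition subst_defset n k m (s : 'I_n -> 'I_k) (p : formula L (n + m)) : formula L (k + m) :=
  frename p (tcat (lshift m \o s) (@rshift k m)).

(** The variables [x, y; b] are reordered as [y; x, b], so that the base point [x] becomes a
    parameter and definability of the dimension applies to fibers. *)
Definition fiber_formula m k (p : formula L ((m + 1) + k)) : formula L (1 + (m + k)) :=
  frename p (tcat (tcat (fun i => rshift 1 (lshift k i)) (lshift (m + k)))
                  (fun j => rshift 1 (rshift m j))).

Definition params_formula n m k (s : 'I_m -> 'I_k) (p : formula L (n + m)) : formula L (n + k) :=
  frename p (tcat (lshift k) (fun j => rshift n (s j))).

Section OneStructure.
Variable M : structure L.
Implicit Types A : set M.

Lemma defset_Top n m (b : 'I_m -> M) : defset (Imp (Bot L (n + m)) (Bot L (n + m))) b = setT.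
Proof. by apply/seteqP; split=> // x _ []. Qed.

Definition point_formula : formula L (1 + 1) :=
  Eq (Var L (@lshift 1 1 ord0)) (Var L (@rshift 1 1 ord0)).

Lemma defset_point (a : M) : defset point_formula (fun _ : 'I_1 => a) = [set fun=> a].
Proof.
apply/seteqP; split=> [x|_ ->]; rewrite /defset /= tcatL tcatR // => xc.
by apply/funext => k; rewrite (ord1 k).
Qed.

Lemma defset_Or n m (p q : formula L (n + m)) (b : 'I_m -> M) :
  defset (fOr p q) b = defset p b `|` defset q b.
Proof. by apply/funext => x; exact: sat_Or. Qed.

Lemma defset_And n m (p q : formula L (n + m)) (b : 'I_m -> M) :
  defset (fAnd p q) b = defset p b `&` defset q b.
Proof. by apply/funext => x; exact: sat_And. Qed.

Lemma defset_subst n k m (s : 'I_n -> 'I_k) (p : formula L (n + m)) (b : 'I_m -> M) :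
  defset (subst_defset s p) b = [set v : 'I_k -> M | defset p b (v \o s)].
Proof.
apply/funext => v; rewrite /defset /= sat_rename comp_tcat compA.
by rewrite tcat_lshift tcat_rshift.
Qed.

Lemma defset_params n m k (s : 'I_m -> 'I_k) (p : formula L (n + m)) (b : 'I_k -> M) :
  defset (params_formula s p) b = defset p (b \o s).
Proof.
apply/funext => v; rewrite /defset /= sat_rename comp_tcat tcat_lshift.
by rewrite -[_ \o (fun j => _)]/((_ \o @rshift n k) \o s) tcat_rshift.
Qed.

Lemma defset_fiber m k (p : formula L ((m + 1) + k)) (b : 'I_k -> M) x :
  defset (fiber_formula p) (tcat x b) = fiber (defset p b) x.
Proof.
apply/funext => y; rewrite /defset /fiber /= sat_rename !comp_tcat tcat_lshift.
rewrite -[_ \o (fun i => rshift 1 (lshift k i))]/((_ \o @rshift 1 _) \o lshift k).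
rewrite -[_ \o (fun j => rshift 1 (rshift m j))]/((_ \o @rshift 1 _) \o @rshift m k).
by rewrite tcat_rshift tcat_lshift tcat_rshift.
Qed.

Lemma definable_common A n n' (X : set ('I_n -> M)) (Y : set ('I_n' -> M)) :
  definable_over A X -> definable_over A Y ->
  exists m (b : 'I_m -> M) (p : formula L (n + m)) (q : formula L (n' + m)),
    [/\ range b `<=` A, X = defset p b & Y = defset q b].
Proof.
move=> [m [p [b [bA ->]]]] [m' [q [c [cA ->]]]].
exists (m + m'), (tcat b c), (params_formula (lshift m') p), (params_formula (@rshift m m') q).
by rewrite range_tcat !defset_params tcat_lshift tcat_rshift; split=> // x [/bA|/cA].
Qed.

Lemma definable_overI A n (X Y : set ('I_n -> M)) :
  definable_over A X -> definable_over A Y -> definable_over A (X `&` Y).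
Proof.
move=> /definable_common h /h[m [b [p [q [bA -> ->]]]]]; exists m, (fAnd p q), b; split=> //.
by rewrite defset_And.
Qed.

Lemma definable_over_preimage A n k (s : 'I_n -> 'I_k) (X : set ('I_n -> M)) :
  definable_over A X -> definable_over A [set v : 'I_k -> M | X (v \o s)].
Proof.
move=> [m [p [b [bA ->]]]]; exists m, (subst_defset s p), b; split=> //.
by rewrite defset_subst.
Qed.

Lemma definable_overT A n : definable_over A [set: 'I_n -> M].
Proof.
exists 0, (Imp (Bot L _) (Bot L _)), (@tnil M).
by split; [move=> x [[]]|rewrite defset_Top].
Qed.

Lemma definable_defset n m (p : formula L (n + m)) (b : 'I_m -> M) : definable (defset p b).
Proof. by exists m, p, b. Qed.

Lemma perm_setE n (s : 'S_n) (S : set ('I_n -> M)) :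
  [set x \o s | x in S] = [set v : 'I_n -> M | S (v \o (s^-1)%g)].
Proof.
apply/seteqP; split=> [_ [x Sx <-]|v /= Sv].
  by rewrite /= (_ : _ \o _ = x) //; apply/funext => i /=; rewrite permKV.
by exists (v \o (s^-1)%g) => //; apply/funext => i /=; rewrite permK.
Qed.

End OneStructure.

Section DimOver.
Variables (T : Type) (cl : set T -> set T).
Hypothesis clM : matroid cl.

Lemma dim_over_setU A n (V W : set ('I_n -> T)) :
  dim_over cl A (V `|` W) = omax (dim_over cl A V) (dim_over cl A W).
Proof.
have geU k : dim_ge cl A (V `|` W) k <-> dim_ge cl A V k \/ dim_ge cl A W k.
  split=> [[b [Vb|Wb] hb]|[[b Vb hb]|[b Wb hb]]]; first by left; exists b.
  - by right; exists b.
  - by exists b => //; left.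
  - by exists b => //; right.
case eV: (dim_over cl A V) => [v|]; last first.
  by move/dim_overN: eV => ->; rewrite set0U.
case eW: (dim_over cl A W) => [w|]; last first.
  by move/dim_overN: eW => ->; rewrite setU0 eV.
move/dim_overP: eV => [gV lV]; move/dim_overP: eW => [gW lW].
apply/dim_overP; rewrite !geU; split.
  by case: leqP => _; [right|left].
by move=> [/(dim_ge_le _) h|/(dim_ge_le _) h]; [apply: lV|apply: lW]; apply: h; rewrite ltnS leq_max leqnn ?orbT.
Qed.

Lemma dim_over_perm A n (s : 'S_n) (V : set ('I_n -> T)) :
  dim_over cl A [set v : 'I_n -> T | V (v \o (s^-1)%g)] = dim_over cl A V.
Proof.
apply: dim_over_eq => k; split=> [[b Vb [J iJ kJ]]|[b Vb [J iJ kJ]]].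
  exists (b \o (s^-1)%g) => //; exists (s @: J); last by rewrite card_imset //; apply: perm_inj.
  have h := independent_comp cl A (b \o (s^-1)%g) J (@perm_inj _ s).
  by apply/h; rewrite (_ : _ \o _ = b) //; apply/funext => i /=; rewrite permK.
exists (b \o s); first by rewrite /= (_ : _ \o _ = b) //; apply/funext => i /=; rewrite permKV.
exists ((s^-1)%g @: J); last by rewrite card_imset //; apply: perm_inj.
have h := independent_comp cl A (b \o s) J (@perm_inj _ (s^-1)%g).
by apply/h; rewrite (_ : _ \o _ = b) //; apply/funext => i /=; rewrite permKV.
Qed.

End DimOver.

Section EdimFun.
Variables (K : structure L) (E : ematroid K).
Local Notation e := (@em_emb _ _ E).
Local Notation cl := (@em_cl _ _ E).

(** On sets that are not definable the value is the default [None]. *)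
Definition edim_fun n (X : set ('I_n -> K)) : option nat := xget None [set l | edim E X l].

Lemma edim_fun_defset n m (p : formula L (n + m)) (b : 'I_m -> K) :
  edim_fun (defset p b) = dim_over cl (range (e \o b)) (defset p (e \o b)).
Proof.
rewrite /edim_fun; apply: xget_unique; first by apply/edim_defset.
by move=> l /edim_defset.
Qed.

Lemma edim_funP n (X : set ('I_n -> K)) l : definable X -> edim E X l <-> edim_fun X = l.
Proof. by move=> [m [p [b [_ ->]]]]; rewrite edim_fun_defset edim_defset. Qed.

Lemma edim_fun_eq0 n (X : set ('I_n -> K)) : definable X -> edim_fun X = None <-> X = set0.
Proof.
move=> [m [p [b [_ ->]]]]; rewrite edim_fun_defset dim_overN; split=> h.
  apply/seteqP; split=> // x px.
  suff : defset p (e \o b) (e \o x) by rewrite h.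
  by rewrite /defset /= -comp_tcat (sat_elementary (em_elementary E)).
have /(defset_elementary (em_elementary E)) : defset p b `<=` defset (Bot L (n + m)) b by rewrite h.
by move=> {}h; apply/seteqP; split.
Qed.

Lemma edim_fun_le n (X : set ('I_n -> K)) l : definable X -> edim_fun X = Some l -> l <= n.
Proof. by move=> [m [p [b [_ ->]]]]; rewrite edim_fun_defset; apply: dim_over_le. Qed.

Lemma edim_fun_dimension : definable_dim E -> dimension_function edim_fun.
Proof.
have clM := ematroid_matroid E; move=> ddim; split; first split.
- by move=> n S; apply: edim_fun_eq0.
- move=> a; rewrite -defset_point edim_fun_defset -[e \o (fun=> a)]/(fun _ : 'I_1 => e a) defset_point.
  apply/dim_overP.
  split; first by apply/dim_ge0; exists (fun=> e a).
  by rewrite dim_over1 // => -[_ -> []]; apply: (cl_ext clM); exists ord0.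
- have eT (N : structure L) : [set: 'I_1 -> N] = defset (Imp (Bot L (1 + 0)) (Bot L _)) (@tnil N).
    by rewrite defset_Top.
  rewrite eT edim_fun_defset (_ : e \o @tnil K = @tnil (em_monster E)); last by apply/funext => -[].
  rewrite -eT; apply/dim_overP; split; last first.
    by move=> [x _ [J _ /leq_trans/(_ (max_card _))]]; rewrite card_ord.
  (* If every point were in the closure of the empty set, the matroid would be trivial. *)
  apply/(dim_over1 clM); have [_ _ _ ntriv] := em_existential E.
  apply: contrapT => /forall2NP h; apply: ntriv => X; apply/seteqP; split=> // a _.
  have [nT|/contrapT] := h (fun=> a); first by case: nT.
  by apply: (cl_mono clM) => x [[]].
- move=> n X Y /definable_common h /h[m [b [p [q [_ -> ->]]]]].
  by rewrite -defset_Or !edim_fun_defset defset_Or dim_over_setU.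
- move=> n S s [m [p [b [_ ->]]]].
  by rewrite perm_setE -defset_subst !edim_fun_defset defset_subst dim_over_perm.
- move=> m U i [k [p [b [_ ->]]]] i1 Ui.
  have [q qP] := ddim 1 (m + k) (fiber_formula p) i i1.
  have UiE : Ui = defset q b.
    apply/funext => x; rewrite /Ui /= -defset_fiber edim_fun_defset; apply/propext; rewrite qP.
    by rewrite (sat_elementary (em_elementary E)).
  split.
    move=> A [k' [p' [b' [b'A eU]]]].
    have [q' q'P] := ddim 1 (m + k') (fiber_formula p') i i1.
    exists k', q', b'; split=> //; apply/funext => x; rewrite /Ui eU /= -defset_fiber edim_fun_defset.
    by apply/propext; rewrite q'P /defset /= (sat_elementary (em_elementary E)).
  rewrite UiE -(defset_subst (lshift 1) q b) -defset_And !edim_fun_defset defset_And defset_subst.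
  (* Here [x] is a tuple of the monster model, possibly outside [K]; its fiber has dimension [i]
     because [q] is correct for parameters in the monster model. *)
  apply: (dim_over_fiber clM) => [//|u []//|x qx].
  have := qx; rewrite /defset /= -qP => <-.
  rewrite setUC -range_tcat defset_fiber; congr dim_over.
  apply/funext => y; rewrite /fiber /setI /=; apply/propext; rewrite tcat_lshift.
  by split=> [[]|].
Qed.

End EdimFun.
End DefinableSets.

(** * Ultraproducts *)

Section UltraFilterFacts.
Variables (I : Type) (mu : set_system I).
Context {Umu : UltraFilter mu}.

Lemma near_not (P : I -> Prop) : (\forall i \near mu, ~ P i) <-> ~ (\forall i \near mu, P i).
Proof.
split=> [h1 h2|h].
  have : \forall i \near mu, False by apply: filterS2 h1 h2.
  exact: filter_not_empty.
by have [] := @in_ultra_setVsetC _ mu [set i | P i] Umu.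
Qed.

Lemma near_imp (P Q : I -> Prop) :
  (\forall i \near mu, P i -> Q i) <-> ((\forall i \near mu, P i) -> \forall i \near mu, Q i).
Proof.
split=> [h hP|h]; first by apply: filterS2 h hP => i; apply.
have [hP|/(near_not _).2 hP] := pselect (\forall i \near mu, P i).
  by apply: filterS (h hP) => i.
by apply: filterS hP => i nP /nP.
Qed.

Lemma near_const (F : finType) (f : I -> F) : exists c, \forall i \near mu, f i = c.
Proof.
apply: contrapT => /forallNP h.
have : \forall i \near mu, forall c, f i <> c by apply: filter_forall => c; apply/near_not.
move=> h'; have : \forall i \near mu, False by apply: filterS h' => i /(_ (f i)).
exact: filter_not_empty.
Qed.

End UltraFilterFacts.

Section Los.
Variables (L : language) (I : Type) (mu : set_system I).
Context {Umu : UltraFilter mu}.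
Variable K : I -> structure L.
Hypothesis Kne : forall i, exists a : K i, True.
Local Notation U := (ultraproduct mu K).
Local Notation utuple := (@utuple L I mu _ K _).
Local Notation uclass := (@uclass L I mu _ K).
Local Notation uset := (@uset L I mu _ K _).

Lemma uclass_eq (f g : forall i, K i) : uclass f = uclass g <-> \forall i \near mu, f i = g i.
Proof. by split=> [/eqmodP/asboolP|h]; last by apply/eqmodP/asboolP. Qed.

Lemma near_repr (f : forall i, K i) : \forall i \near mu, (repr (uclass f) : forall i, K i) i = f i.
Proof. by apply/uclass_eq; rewrite /Defs.uclass reprK. Qed.

Lemma utuple_eq n (x y : forall i, 'I_n -> K i) :
  utuple x = utuple y <-> \forall i \near mu, x i = y i.
Proof.
split=> [h|h].
  have : \forall i \near mu, forall j, x i j = y i j.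
    by apply: filter_forall => j; apply/uclass_eq; exact: (congr1 (@^~ j) h).
  by apply: filterS => i hi; apply/funext.
by apply/funext => j; apply/uclass_eq; apply: filterS h => i ->.
Qed.

Lemma utuple_surj n (v : 'I_n -> U) : exists x, v = utuple x.
Proof.
exists (fun i j => (repr (v j) : forall i, K i) i); apply/funext => j.
by rewrite /Defs.utuple /Defs.uclass reprK.
Qed.

Lemma utuple_tcons n a (x : forall i, 'I_n -> K i) :
  tcons (uclass a) (utuple x) = utuple (fun i => tcons (a i) (x i)).
Proof.
apply/funext => k; rewrite /Defs.utuple; case: (unliftP ord0 k) => [j|] ->.
  by rewrite tconsS; apply/uclass_eq; apply: filterE => i; rewrite tconsS.
by rewrite tcons0; apply/uclass_eq; apply: filterE => i; rewrite tcons0.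
Qed.

Lemma utuple_tcat n m (x : forall i, 'I_n -> K i) (y : forall i, 'I_m -> K i) :
  tcat (utuple x) (utuple y) = utuple (fun i => tcat (x i) (y i)).
Proof.
apply/funext => k; rewrite /Defs.utuple; case: (split_ordP k) => j ->.
  by rewrite tcatL; apply/uclass_eq; apply: filterE => i; rewrite tcatL.
by rewrite tcatR; apply/uclass_eq; apply: filterE => i; rewrite tcatR.
Qed.

Lemma teval_ultraproduct n (t : term L n) (x : forall i, 'I_n -> K i) :
  @teval L U n (utuple x) t = uclass (fun i => teval (x i) t).
Proof.
elim: t => [//|f ts IH] /=; apply/uclass_eq.
have : \forall i \near mu, forall j,
    (repr (@teval L U n (utuple x) (ts j)) : forall i, K i) i = teval (x i) (ts j).
  by apply: filter_forall => j; rewrite IH; apply: near_repr.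
by apply: filterS => i h; congr finterp; apply/funext => j.
Qed.

Lemma Los n (p : formula L n) (x : forall i, 'I_n -> K i) :
  @sat L U n p (utuple x) <-> \forall i \near mu, sat p (x i).
Proof.
elim: p x => {n} [n|n s t|n r ts|n p IHp q IHq|n p IH] x.
- by split=> [[]|]; apply: filter_not_empty.
- by rewrite /= !teval_ultraproduct uclass_eq.
- have h : \forall i \near mu, forall j,
      (repr (@teval L U n (utuple x) (ts j)) : forall i, K i) i = teval (x i) (ts j).
    by apply: filter_forall => j; rewrite teval_ultraproduct; apply: near_repr.
  by split=> hr; apply: filterS2 h hr => i e; rewrite -[X in _ -> X]/(rinterp _) /=;
    rewrite -?(funext e) ?(funext e).
- by rewrite /= IHp IHq near_imp.
- split=> /= [h|h a].
    apply: contrapT => /(near_not _).2 nh.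
    (* Counterexamples are chosen in all factors at once; where there is none, [Kne] supplies an
       arbitrary element. *)
    have ex i : exists a, (~ forall a, sat p (tcons a (x i))) -> ~ sat p (tcons a (x i)).
      have [h'|/existsNP[a ha]] := pselect (forall a, sat p (tcons a (x i))); last by exists a.
      by have [a _] := Kne i; exists a.
    pose a i := sval (cid (ex i)); have aP i := svalP (cid (ex i)).
    have := h (uclass a); rewrite utuple_tcons IH => hp.
    have : \forall i \near mu, False by apply: filterS2 nh hp => i /aP.
    exact: filter_not_empty.
  have -> : a = uclass (repr a) by rewrite /Defs.uclass reprK.
  by rewrite utuple_tcons IH; apply: filterS h => i.
Qed.

Lemma usetE n (X : forall i, set ('I_n -> K i)) x :
  uset X (utuple x) <-> \forall i \near mu, X i (x i).
Proof.
split=> [[y Xy /utuple_eq xy]|h]; last by exists x.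
by apply: filterS2 xy Xy => i ->.
Qed.

Lemma defset_ultraproduct n m (p : formula L (n + m)) (b : forall i, 'I_m -> K i) :
  @defset L U n m p (utuple b) = uset (fun i => defset p (b i)).
Proof.
apply/funext => v; have [x ->] := utuple_surj v.
by apply/propext; rewrite usetE /defset /= utuple_tcat Los.
Qed.

(** The factors are arbitrary sets, so this is no instance of the theorem of Los: if inclusion fails
    almost everywhere, the counterexamples together form a counterexample in the ultraproduct. *)
Lemma uset_sub n (X Y : forall i, set ('I_n -> K i)) :
  uset X `<=` uset Y <-> \forall i \near mu, X i `<=` Y i.
Proof.
split=> [h|h v].
  apply: contrapT => /(near_not _).2 nh.
  have ex i : exists x, (~ X i `<=` Y i) -> X i x /\ ~ Y i x.
    have [h'|/existsNP[x /not_implyP hx]] := pselect (X i `<=` Y i); last by exists x.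
    by have [a _] := Kne i; exists (fun=> a).
  pose x i := sval (cid (ex i)); have xP i := svalP (cid (ex i)).
  have hX : uset X (utuple x) by apply/usetE; apply: filterS nh => i /xP[].
  have /usetE hY := h _ hX.
  have : \forall i \near mu, False by apply: filterS2 nh hY => i /xP[].
  exact: filter_not_empty.
by have [x ->] := utuple_surj v; rewrite !usetE; apply: filterS2 h => i; apply.
Qed.

Lemma uset_eq n (X Y : forall i, set ('I_n -> K i)) :
  uset X = uset Y <-> \forall i \near mu, X i = Y i.
Proof.
split=> [/seteqP[/uset_sub h1 /uset_sub h2]|h].
  by apply: filterS2 h1 h2 => i ? ?; apply/seteqP.
by apply/seteqP; split; apply/uset_sub; apply: filterS h => i ->.
Qed.

Lemma uset0 n (X : forall i, set ('I_n -> K i)) :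
  uset X = set0 <-> \forall i \near mu, X i = set0.
Proof.
have <- : uset (fun i => (set0 : set ('I_n -> K i))) = set0; last exact: uset_eq.
apply/seteqP; split=> // v [x /= hx _].
by apply: filter_not_empty hx.
Qed.

End Los.

(** * The dimension of an ultraproduct *)

(** Unlike in [definable_dim], the parameters are taken in [K] itself. This is the form that passes
    to the ultraproduct and, with the dimension axioms, produces the matroid. *)
Definition dim_definable L (K : structure L) (d : forall n, set ('I_n -> K) -> option nat) :=
  forall n m (p : formula L (n + m)) l, l <= n ->
    exists q : formula L m, forall y : 'I_m -> K, d n (defset p y) = Some l <-> sat q y.

Lemma dim_definable_fiber L (M : structure L) (d : forall n, set ('I_n -> M) -> option nat) m i (X : set ('I_(m + 1) -> M)) A :
  dim_definable d -> i <= 1 -> definable_over A X ->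
  definable_over A [set x | d 1 (fiber X x) = Some i].
Proof.
move=> dd i1 [k [p [b [bA ->]]]]; have [q qP] := dd 1 (m + k) (fiber_formula p) i i1.
exists k, q, b; split=> //; apply/funext => x.
by apply/propext; rewrite /= -defset_fiber qP.
Qed.

Section UltraDim.
Variables (L : language) (I : Type) (mu : set_system I).
Context {Umu : UltraFilter mu}.
Variable K : I -> structure L.
Variable E : forall i, ematroid (K i).
Local Notation U := (ultraproduct mu K).

Local Notation ut := (@utuple L I mu (@filter_filter I mu (@ultra_proper I mu Umu)) K _).

Let Kne i : exists a : K i, True. Proof. exact: ematroid_inhabited (E i). Qed.

Definition udim n (X : set ('I_n -> U)) : option nat :=
  xget None [set l | exists Y : forall i, set ('I_n -> K i),
    [/\ forall i, definable (Y i), X = uset mu Y & \forall i \near mu, edim (E i) (Y i) l]].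

Lemma udim_uset n (Y : forall i, set ('I_n -> K i)) l : (forall i, definable (Y i)) ->
  udim (uset mu Y) = l <-> \forall i \near mu, edim_fun (E i) (Y i) = l.
Proof.
move=> Ydef.
have [c hc] : exists l, \forall i \near mu, edim_fun (E i) (Y i) = l.
  (* Dimensions in n-space are at most [n], so [inord] loses nothing and brings the values into a
     finite type. *)
  have [c hc] := near_const (fun i => omap (inord : nat -> 'I_n.+1) (edim_fun (E i) (Y i))).
  exists (omap val c); apply: filterS hc => i <-.
  case e: (edim_fun _ _) => [k|//]; rewrite /= inordK // ltnS.
  exact: edim_fun_le e.
have -> : udim (uset mu Y) = c.
  apply: xget_unique; first by exists Y; split=> //; apply: filterS hc => i /edim_funP; apply.
  move=> l' [Y' [Y'def eY hY']]; have YY' := (uset_eq Kne Y Y').1 eY.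
  apply: contrapT => l'c; apply: (@filter_not_empty _ mu _).
  apply: filterS3 hc YY' hY' => i /= e <- /(edim_funP _ _ (Ydef i)).
  by rewrite e => /esym.
split=> [<- //|hl]; apply: contrapT => cl; apply: (@filter_not_empty _ mu _).
by apply: filterS2 hc hl => i -> /cl.
Qed.

Lemma udim_defset n m (p : formula L (n + m)) (b : forall i, 'I_m -> K i) l :
  udim (@defset L U n m p (ut b)) = l <->
  \forall i \near mu, edim_fun (E i) (defset p (b i)) = l.
Proof. by rewrite defset_ultraproduct //; apply: udim_uset => i; apply: definable_defset. Qed.

Lemma ultra_dim_udim : ultra_dim E udim.
Proof.
move=> n X Xdef _ l; rewrite udim_uset //.
by split; apply: filterS => i /edim_funP; apply.
Qed.

Lemma ultra_dim_unique d : ultra_dim E d ->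
  forall n (X : set ('I_n -> U)), definable X -> d n X = udim X.
Proof.
move=> dU n X Xdef; have [m [p [v [_ eX]]]] := Xdef; have [b ev] := utuple_surj v.
move: Xdef; rewrite eX ev defset_ultraproduct // => Xdef.
have ddef i : definable (defset p (b i)) by apply: definable_defset.
apply: (dU _ _ ddef Xdef _).2.
exact: (ultra_dim_udim ddef Xdef _).1.
Qed.

Hypothesis Edef : forall i, definable_dim (E i).
Hypothesis Eunif : uniformly_definable E.

Lemma udim_definable : dim_definable udim.
Proof.
move=> n m p l ln; have [q qP] := Eunif p ln; exists q => v.
have [y ->] := utuple_surj v; rewrite udim_defset Los //.
split; apply: filterS => i h.
  by apply/qP/edim_funP => //; apply: definable_defset.
by apply/edim_funP; [apply: definable_defset|apply/qP].
Qed.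

Lemma udim_dimension : dimension_function udim.
Proof.
have Ed i := edim_fun_dimension (Edef i).
split; first split.
- move=> n S [m [p [v [_ ->]]]]; have [b ->] := utuple_surj v.
  rewrite udim_defset defset_ultraproduct // uset0 //.
  by split; apply: filterS => i /edim_fun_eq0; apply; apply: definable_defset.
- move=> a; rewrite -defset_point.
  have -> : (fun=> a) = ut (fun i (_ : 'I_1) => (repr a : forall i, K i) i).
    by apply/funext => k; rewrite /utuple /uclass reprK.
  apply/udim_defset; apply: filterE => i; rewrite defset_point.
  by have [[_ h _] _ _ _] := Ed i; apply: h.
- have [b eb] := utuple_surj (@tnil U).
  rewrite -(@defset_Top _ U 1 0 (@tnil U)) eb; apply/udim_defset; apply: filterE => i.
  by rewrite defset_Top; have [[_ _ h] _ _ _] := Ed i; apply: h.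
- move=> n S1 S2 /definable_common h /h[m [v [p [q [_ -> ->]]]]]; have [b ->] := utuple_surj v.
  rewrite -defset_Or; apply/udim_defset.
  have /udim_defset h1 := erefl (udim (@defset L U n m p (ut b))).
  have /udim_defset h2 := erefl (udim (@defset L U n m q (ut b))).
  apply: filterS2 h1 h2 => i <- <-; have [_ D2 _ _] := Ed i.
  by rewrite defset_Or D2 //; apply: definable_defset.
- move=> n S s [m [p [v [_ ->]]]]; have [b ->] := utuple_surj v.
  rewrite perm_setE -defset_subst; apply/udim_defset.
  have /udim_defset h1 := erefl (udim (@defset L U n m p (ut b))).
  apply: filterS h1 => i <-; have [_ _ D3 _] := Ed i.
  by rewrite defset_subst -perm_setE D3 //; apply: definable_defset.
- move=> m S i [k [p [v [_ ->]]]] i1 Si; split.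
    by move=> A; apply: dim_definable_fiber => //; apply: udim_definable.
  (* Uniformity gives one [q] that defines the points with [i]-dimensional fiber in every factor, so
     [Si] is the ultraproduct of these sets and (Dim 4) can be read off factor by factor. *)
  have [b eb] := utuple_surj v; have [q qP] := Eunif (fiber_formula p) i1.
  have qP' j (c : 'I_k -> K j) :
      defset q c = [set x | edim_fun (E j) (fiber (defset p c) x) = Some i].
    apply/funext => x; apply/propext; rewrite /= -defset_fiber.
    have := edim_funP (E j) (Some i) (definable_defset (fiber_formula p) (tcat x c)).
    by rewrite qP.
  have SiE : Si = defset q v.
    apply/funext => w; have [x ->] := utuple_surj w; apply/propext.
    have -> : Si (ut x) = (udim (fiber (defset p (ut b)) (ut x)) = Some i) by rewrite -eb.
    rewrite -defset_fiber utuple_tcat udim_defset eb defset_ultraproduct //.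
    split=> [h|/(usetE _ _).1 h]; [apply: (usetE _ _).2|]; apply: filterS h => j.
      by rewrite qP' defset_fiber.
    by rewrite qP' defset_fiber.
  rewrite SiE -(defset_subst (lshift 1) q v) -defset_And eb; apply/udim_defset.
  have /udim_defset h1 := erefl (udim (@defset L U m k q (ut b))).
  apply: filterS h1 => j <-; have [_ _ _ D4] := Ed j.
  have [_] := D4 m (defset p (b j)) i (definable_defset _ _) i1.
  by rewrite defset_And defset_subst qP'.
Qed.

(** The formula witnessing closure in the ultraproduct has dimension 0 and contains [a i] in almost
    every factor, and a point of a zero-dimensional set lies in the closure of its parameters. *)
Lemma dim_cl_udim (a : forall i, K i) m (b : forall i, 'I_m -> K i) :
  dim_cl udim (range (ut b)) (uclass mu a) ->
  \forall i \near mu, mcl (E i) (range (b i)) (a i).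
Proof.
move=> [X [[k [p [v [vb ->]]]] dX Xa]].
(* The parameters of the witness are entries of [b]; [s] records which, so that they have
   representatives among the entries of [b i]. *)
have /choice[s sP] j : exists s, ut b s = v j.
  by have [|s _ ?] := vb (v j); [exists j|exists s].
have ev : v = ut (fun i => b i \o s) by apply/funext => j; rewrite -sP.
move: dX Xa; rewrite ev udim_defset => dX.
rewrite /defset /= -[fun=> _]/(ut (fun i (_ : 'I_1) => a i)) utuple_tcat Los // => Xa.
apply: filterS2 dX Xa => i; rewrite edim_fun_defset => /dim_overP[_ n1] pa.
have clM := ematroid_matroid (E i).
suff : @em_cl _ _ (E i) (range (@em_emb _ _ (E i) \o (b i \o s))) (@em_emb _ _ (E i) (a i)).
  by apply: (cl_mono clM) => _ [j _ <-]; exists (b i (s j)) => //; exists (s j).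
apply: contrapT => na; apply: n1; apply/(dim_over1 clM).
exists (fun=> @em_emb _ _ (E i) (a i)) => //.
rewrite /defset /= -[fun=> _]/(@em_emb _ _ (E i) \o (fun _ : 'I_1 => a i)) -comp_tcat.
by rewrite (sat_elementary (em_elementary (E i))).
Qed.

End UltraDim.

(** * The matroid of a definable dimension function *)

Lemma finite_set_range T (A : set T) : finite_set A -> exists n (v : 'I_n -> T), A = range v.
Proof.
move=> /finite_set_leP[n /card_le_rel[R [Rtot Rinj]]].
have [->|/set0P[x0 Ax0]] := eqVneq A set0.
  by exists 0, (@tnil T); apply/seteqP; split=> // x [[]].
have /choice[v vP] (i : 'I_n) : exists x, A x /\ ((exists2 y, A y & R y i) -> R x i).
  by have [[y Ay Ry]|h] := pselect (exists2 y, A y & R y i); [exists y|exists x0].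
exists n, v; apply/seteqP; split=> [x Ax|_ [i _ <-]]; last by case: (vP i).
have [i /= ni Rx] := Rtot x Ax; exists (Ordinal ni) => //.
have [Av h] := vP (Ordinal ni); apply: (Rinj _ _ i) => //.
by apply: h; exists x.
Qed.

Section DimensionMatroid.
Variables (L : language) (K : structure L) (d : forall n, set ('I_n -> K) -> option nat).

Arguments d : clear implicits.
Hypothesis dF : dimension_function d.
Hypothesis dD : dim_definable d.

(* On definable sets: of dimension at most 0. *)
Definition thin (X : set ('I_1 -> K)) := d 1 X <> Some 1.

Lemma dim1_le1 X : definable X -> d 1 X = None \/ d 1 X = Some 0 \/ d 1 X = Some 1.
Proof.
move=> Xd; case: dF => -[_ _ dT] dU _ _.
have := dU _ X setT Xd (definable_overT _ _); rewrite setUT dT.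
case: (d 1 X) => [[|[|k]]|]; [by right; left|by right; right| |by left].
by rewrite /= => -[].
Qed.

Lemma thin_sub X Y : definable X -> definable Y -> X `<=` Y -> thin Y -> thin X.
Proof.
move=> Xd Yd XY; apply: contra_not => dX; case: dF => _ dU _ _.
have := dU _ X Y Xd Yd; rewrite (setUidPr _ _).2 // dX.
by case: (dim1_le1 Yd) => [|[|]] -> // [].
Qed.

Lemma thin_setU X Y : definable X -> definable Y -> thin X -> thin Y -> thin (X `|` Y).
Proof.
move=> Xd Yd; rewrite /thin; case: dF => _ -> // _ _.
by case: (dim1_le1 Xd) => [|[|]] ->; case: (dim1_le1 Yd) => [|[|]] ->.
Qed.

Lemma thin0 : thin set0.
Proof.
case: dF => -[dN _ _] _ _ _; rewrite /thin.
suff -> : d 1 set0 = None by [].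
by apply/dN => //; exists 0, (Bot L (1 + 0)), (@tnil K); split=> //; apply/seteqP; split.
Qed.

Lemma thin_dim X : definable X -> thin X -> X !=set0 -> d 1 X = Some 0.
Proof.
move=> Xd Xt /set0P/eqP X0; case: (dim1_le1 Xd) => [e|[//|/Xt//]].
by case: dF => -[dN _ _] _ _ _; case: X0; apply/dN.
Qed.

Definition pair2 (x y : K) : 'I_(1 + 1) -> K := tcat (fun _ : 'I_1 => x) (fun _ : 'I_1 => y).

Definition flip (U : set ('I_(1 + 1) -> K)) : set ('I_(1 + 1) -> K) :=
  [set v : 'I_(1 + 1) -> K | U (v \o tperm (lshift 1 ord0) (rshift 1 ord0))].

Lemma flip_pair2 U x y : flip U (pair2 x y) = U (pair2 y x).
Proof.
rewrite /flip /=; congr U; apply/funext => k /=; case: (split_ordP k) => j ->; rewrite (ord1 j).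
  by rewrite tpermL /pair2 tcatL tcatR.
by rewrite tpermR /pair2 tcatL tcatR.
Qed.

Lemma flip_definable U : definable U -> definable (flip U).
Proof. exact: definable_over_preimage. Qed.

Lemma dim_flip U : definable U -> d (1 + 1) (flip U) = d (1 + 1) U.
Proof.
move=> Ud; case: dF => _ _ D3 _.
by rewrite -(D3 _ U (tperm (lshift 1 ord0) (rshift 1 ord0)) Ud) perm_setE tpermV.
Qed.

Lemma fiber_definable U x : definable U -> definable (@fiber K 1 U x).
Proof. by move=> [m [p [b [_ ->]]]]; rewrite -defset_fiber; apply: definable_defset. Qed.

(** All nonempty fibers have dimension 0, so [U] lies entirely over [B], and (Dim 4) applies with
    [i = 0]. *)
Lemma thin_fibers U : definable U -> (forall x, thin (@fiber K 1 U x)) ->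
  let B := [set x | fiber U x !=set0] in definable B /\ d (1 + 1) U = d 1 B.
Proof.
move=> Ud Ut B; case: dF => -[dN _ _] _ _ /(_ 1 U 0 Ud isT)[Bd dUB].
have BE : [set x | d 1 (fiber U x) = Some 0] = B.
  apply/seteqP; split=> x /=; last by apply: thin_dim => //; apply: fiber_definable.
  move=> e; apply/set0P/eqP => e'; move: e.
  by have := (dN _ _ (fiber_definable x Ud)).2 e' => ->.
move: dUB Bd; rewrite BE => dUB /(_ setT Ud) Bd; split=> //.
have -> : d 1 B = omap (addn 0) (d 1 B) by case: (d 1 B).
rewrite -dUB; congr (d _ _); apply/seteqP; split=> [u Uu|u []//].
by split=> //; exists (u \o @rshift 1 1); rewrite /fiber /= tcat_split.
Qed.

(** The fibers of [U] are thin in both directions, those of the second projection being contained in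
    [B]. Hence [U] has the dimension of either projection, and the first lies in [B]. *)
Lemma thin_image U (B : set ('I_1 -> K)) : definable U -> definable B -> thin B ->
  (forall x y, U (pair2 x y) -> B (fun=> x)) -> (forall x, thin (@fiber K 1 U x)) ->
  thin [set y | exists x, U (pair2 x (y ord0))].
Proof.
move=> Ud Bd Bt UB Ut; have Vd := flip_definable Ud.
have Vt y : thin (@fiber K 1 (flip U) y).
  apply: thin_sub Bt => //; first exact: fiber_definable.
  by move=> x; rewrite /fiber /= (tuple1 y) (tuple1 x) -/(pair2 _ _) flip_pair2; apply: UB.
have [Cd dU] := thin_fibers Ud Ut; have [Wd dV] := thin_fibers Vd Vt.
have -> : [set y | exists x, U (pair2 x (y ord0))] = [set x | fiber (flip U) x !=set0].
  apply/funext => y; apply/propext; rewrite (tuple1 y); split=> [[x Ux]|[x]].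
    by exists (fun=> x); rewrite /fiber /= -/(pair2 _ _) flip_pair2.
  by rewrite /fiber /= (tuple1 x) -/(pair2 _ _) flip_pair2 => ?; exists (x ord0).
rewrite /thin -dV dim_flip // dU; apply: thin_sub Bt => // x [y].
by rewrite /fiber /= (tuple1 y) (tuple1 x) -/(pair2 _ _); apply: UB.
Qed.

(** Otherwise the part of [U] over this set would have dimension 2; but the other projection has
    thin fibers, which bounds its dimension by 1. *)
Lemma thin_wide_fibers U : definable U ->
  (forall y, thin [set x | U (pair2 (x ord0) y)]) ->
  thin [set x | d 1 (@fiber K 1 U x) = Some 1].
Proof.
move=> Ud Ut dP; case: dF => _ _ _ /(_ 1 U 1 Ud isT)[Pd dUP].
set P := [set x | _] in dP dUP Pd; move: dUP; rewrite dP.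
set W := (X in d _ X) => dW.
have Wd : definable W.
  by apply: definable_overI => //; apply: definable_over_preimage; apply: Pd.
have Vt y : thin (@fiber K 1 (flip W) y).
  have fE X : @fiber K 1 (flip X) y = [set x | X (pair2 (x ord0) (y ord0))].
    by apply/funext => x; rewrite /fiber /= (tuple1 y) (tuple1 x) -/(pair2 _ _) flip_pair2.
  have := Ut (y ord0); rewrite -(fE U); apply: thin_sub.
  - by apply: fiber_definable; apply: flip_definable.
  - by apply: fiber_definable; apply: flip_definable.
  - by move=> x [].
have [Cd dV] := thin_fibers (flip_definable Wd) Vt.
by move: dW; rewrite -(dim_flip Wd) dV; case: (dim1_le1 Cd) => [|[|]] ->.
Qed.

Definition dim_narrow m (p : formula L m.+1) := forall y, thin (@defset L K 1 m p y).

(** * The closure operator of narrow formulas *)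

Section Extension.
Variable M : structure L.
Implicit Types X : set M.

Definition ext_cl X : set M := [set a | exists m (p : formula L m.+1) (b : 'I_m -> M),
  [/\ dim_narrow p, range b `<=` X & sat p (tcons a b)]].

Lemma sat_defset1 (N : structure L) m (p : formula L (1 + m)) (b : 'I_m -> N) a :
  defset p b (fun=> a) = sat p (tcons a b).
Proof. by rewrite /defset /= tcat1. Qed.

Lemma dim_narrow_params m k (s : 'I_m -> 'I_k) (p : formula L (1 + m)) :
  dim_narrow p -> @dim_narrow k (params_formula s p).
Proof. by move=> np y; rewrite defset_params. Qed.

Lemma ext_cl_split X c a : ext_cl (X `|` [set c]) a ->
  exists m (p : formula L m.+2) (b : 'I_m -> M),
    [/\ dim_narrow p, range b `<=` X & sat p (tcons a (tcons c b))].
Proof.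
move=> [m0 [p [b0 [np bX pa]]]]; have [m [b [s [bX' eb _]]]] := split_params bX.
exists m, (@params_formula L 1 _ _ s p), b; split=> //; first exact: (@dim_narrow_params _ _ s p).
by rewrite -sat_defset1 defset_params sat_defset1 -eb.
Qed.

Definition swap01 m : 'I_m.+2 -> 'I_m.+2 :=
  tcons (lift ord0 ord0) (tcons ord0 (fun j => lift ord0 (lift ord0 j))).

Definition skip1 m : 'I_m.+1 -> 'I_m.+2 := tcons ord0 (fun j => lift ord0 (lift ord0 j)).

Lemma comp_swap01 T m (x y : T) (v : 'I_m -> T) :
  tcons x (tcons y v) \o @swap01 m = tcons y (tcons x v).
Proof.
rewrite /swap01 !comp_tcons !tcons0 !tconsS !tcons0; congr (tcons _ (tcons _ _)).
by apply/funext => j /=; rewrite !tconsS.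
Qed.

Lemma comp_skip1 T m (x y : T) (v : 'I_m -> T) : tcons x (tcons y v) \o @skip1 m = tcons x v.
Proof.
rewrite /skip1 comp_tcons tcons0; congr (tcons _ _).
by apply/funext => j /=; rewrite !tconsS.
Qed.

Lemma defset2 (N : structure L) m (p : formula L (1 + 1 + m)) (b : 'I_m -> N) x y :
  defset p b (tcat (fun _ : 'I_1 => x) (fun _ : 'I_1 => y)) = sat p (tcons x (tcons y b)).
Proof. by rewrite /defset /= tcat1 tcat_tcons tcat1. Qed.

(** Narrow formulas compose: with [q(z)] and [p(x, z)] narrow, so is their conjunction quantified
    existentially over [z], by [thin_image]. *)
Lemma ext_cl_cut X c a : ext_cl (X `|` [set c]) a -> ext_cl X c -> ext_cl X a.
Proof.
move=> /ext_cl_split[m [p [b [np bX pa]]]] [m' [q [b' [nq b'X qc]]]].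
pose sL : 'I_m.+1 -> 'I_(m + m').+1 := lift_ren (lshift m').
pose p1 : formula L (m + m').+2 := frename p (@swap01 _ \o lift_ren sL).
pose q1 : formula L (m + m').+1 := @params_formula L 1 _ _ (@rshift m m') q.
pose r := fAnd (frename q1 (@skip1 _)) p1.
have eL T x (u : 'I_m -> T) (u' : 'I_m' -> T) : tcons x (tcat u u') \o sL = tcons x u.
  rewrite /sL /lift_ren comp_tcons tcons0 -[_ \o (fun i => _)]/((_ \o lift ord0) \o lshift m').
  by rewrite comp_lift0 tcat_lshift.
have rE (N : structure L) z x (u : 'I_m -> N) (u' : 'I_m' -> N) :
    sat r (tcons z (tcons x (tcat u u'))) = (sat q (tcons z u') /\ sat p (tcons x (tcons z u))).
  have q1E : sat q1 (tcons z (tcat u u')) = sat q (tcons z u').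
    by rewrite -(@sat_defset1 N (m + m') q1) defset_params tcat_rshift sat_defset1.
  rewrite /r sat_And (sat_rename q1) comp_skip1 q1E (sat_rename p).
  rewrite compA comp_swap01 /lift_ren comp_tcons tcons0.
  by rewrite -[_ \o (fun i => _)]/((_ \o lift ord0) \o sL) comp_lift0 eL.
exists (m + m'), (fEx r), (tcat b b'); split; last by rewrite sat_Ex; exists c; rewrite rE.
  move=> y; rewrite -(tcat_split y); set u := y \o _; set u' := y \o _.
  have -> : @defset L K 1 _ (fEx r) (tcat u u') =
      [set v | exists z, @defset L K (1 + 1) _ r (tcat u u') (pair2 z (v ord0))].
    apply/funext => v; rewrite (tuple1 v) sat_defset1 sat_Ex.
    by apply: eq_exists => z; rewrite /pair2 defset2.
  apply: (@thin_image _ (@defset L K 1 _ q u')) => //; first exact: definable_defset.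
  - exact: definable_defset.
  - by move=> z x; rewrite /pair2 defset2 rE sat_defset1 => -[].
  - move=> z; apply: (thin_sub _ _ _ (np (tcons (z ord0) u))); last 1 first.
    + move=> x; rewrite /fiber /mkset (tuple1 z) (tuple1 x) defset2 rE => -[_].
      by rewrite sat_defset1.
    + by apply: fiber_definable; apply: definable_defset.
    + exact: definable_defset.
by rewrite range_tcat => x [/bX|/b'X].
Qed.

Lemma ext_cl_mono X Y : X `<=` Y -> ext_cl X `<=` ext_cl Y.
Proof. by move=> XY a [m [p [b [np bX pa]]]]; exists m, p, b; split=> // x /bX/XY. Qed.

Lemma ext_cl_ext X : X `<=` ext_cl X.
Proof.
move=> a Xa; exists 1, (point_formula L), (fun=> a); split.
- move=> y; rewrite (tuple1 y) defset_point /thin; case: dF => -[_ -> _] _ _ _ //.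
- by move=> _ [_ _ <-].
- by rewrite -(@sat_defset1 M 1 (point_formula L)) defset_point.
Qed.

(** The finitely many parameters lying in the closure are eliminated one at a time by
    [ext_cl_cut]. *)
Lemma ext_cl_idem X : ext_cl (ext_cl X) = ext_cl X.
Proof.
apply/seteqP; split; last by apply: ext_cl_mono; apply: ext_cl_ext.
suff cut m (b : 'I_m -> M) : range b `<=` ext_cl X -> ext_cl (X `|` range b) `<=` ext_cl X.
  move=> a [m [p [b [np bX pa]]]]; apply: (cut m b bX).
  by exists m, p, b; split=> // x bx; right.
elim: m b => [|m IH] b bX a.
  by apply: ext_cl_mono => x [//|[[]]].
rewrite -(tcons_split b) range_tcons (setUC [set _]) setUA => /ext_cl_cut h.
apply: (IH (b \o lift ord0)); first by move=> x hx; apply: bX; apply: range_comp_sub hx.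
apply: h; apply: (@ext_cl_mono X); first by left.
by apply: bX; exists ord0.
Qed.

(* Let [p(a, c)] with [p] narrow.  By additivity in both orders, the set of all [x]
   such that [p(x, z)] holds for a one-dimensional set of [z] is thin; it does not
   contain [a], so [c] is in the thin set defined by [p(a, z)]. *)
Lemma ext_cl_exchange X a c :
  (ext_cl (X `|` [set c]) `\` ext_cl X) a -> ext_cl (X `|` [set a]) c.
Proof.
move=> [/ext_cl_split[m [p [b [np bX pa]]]] na].
have [q qP] := @dD 1 m.+1 (@fiber_formula L 1 m p) 1 isT.
have qP' (y : 'I_m -> K) x : sat q (tcons x y) <-> d 1 (fiber (@defset L K (1 + 1) m p y) (fun=> x)) = Some 1.
  by rewrite -defset_fiber -qP tcat1.
have nq : dim_narrow q.
  move=> y; have -> : @defset L K 1 m q y =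
      [set x | d 1 (fiber (@defset L K (1 + 1) m p y) x) = Some 1].
    apply/funext => x; rewrite (tuple1 x) sat_defset1; apply/propext; exact: qP'.
  apply: thin_wide_fibers => [|z]; first exact: definable_defset.
  suff -> : [set x | @defset L K (1 + 1) m p y (pair2 (x ord0) z)] = @defset L K 1 m.+1 p (tcons z y) by [].
  by apply/funext => x; rewrite (tuple1 x) sat_defset1 /pair2 /mkset defset2.
have fE (N : structure L) (y : 'I_m -> N) x z :
    sat (@fiber_formula L 1 m p) (tcons z (tcons x y)) = sat p (tcons x (tcons z y)).
  rewrite -(@sat_defset1 N (1 + m) (@fiber_formula L 1 m p)) -tcat1 defset_fiber.
  by rewrite /fiber /mkset defset2.
pose r : formula L m.+2 := fAnd (@fiber_formula L 1 m p) (fNot (frename q (lift ord0))).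
have rE (N : structure L) (y : 'I_m -> N) x z : sat r (tcons z (tcons x y)) =
    (sat p (tcons x (tcons z y)) /\ ~ sat q (tcons x y)).
  by rewrite /r sat_And sat_Not sat_rename fE comp_lift0.
exists m.+1, r, (tcons a b); split.
- move=> y; rewrite -(tcons_split y); set x := y _; set u := y \o _.
  have [qx|nqx] := pselect (sat q (tcons x u)).
    suff -> : @defset L K 1 m.+1 r (tcons x u) = set0 by exact: thin0.
    by apply/seteqP; split=> // z; rewrite (tuple1 z) sat_defset1 rE => -[].
  have ft : thin (fiber (@defset L K (1 + 1) m p u) (fun=> x)) by move=> /qP'.
  apply: thin_sub ft; [exact: (@definable_defset _ _ 1 m.+1)|by apply: fiber_definable; apply: definable_defset|].
  move=> z; rewrite (tuple1 z) sat_defset1 rE => -[pz _].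
  by rewrite /fiber /mkset defset2.
- by rewrite range_tcons => x [->|/bX]; [right|left].
- rewrite rE; split=> // qa; apply: na; exists m, q, b; by split.
Qed.

Lemma ext_cl_matroid : matroid ext_cl.
Proof.
split; [exact: ext_cl_ext|exact: ext_cl_mono|exact: ext_cl_idem| |exact: ext_cl_exchange].
move=> X; apply/seteqP; split=> [a [m [p [b [np bX pa]]]]|a [A [_ AX]]].
  by exists (range b); split=> //; [apply: finite_range|exists m, p, b; split].
exact: ext_cl_mono.
Qed.

Lemma ext_cl_definable : definable_matroid ext_cl.
Proof.
move=> A; apply/seteqP; split=> a [m [p [b [np bA pa]]]].
  exists m, p, b; split=> // a' b' pa'; exists m, p, b'; by split.
exact: (ext_cl_mono bA (np _ _ pa)).
Qed.

End Extension.

End DimensionMatroid.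

(** The universal closure of [p] turns a property of all tuples of [K] into one sentence, which
    passes to [M]. *)
Lemma elementary_forall L (K M : structure L) (e : K -> M) n (p : formula L n) :
  elementary e -> (forall v : 'I_n -> K, sat p v) -> forall v : 'I_n -> M, sat p v.
Proof.
move=> eel pK v; pose c := @fAlls L 0 n (frename p (lshift 0)).
have cE (N : structure L) (u : 'I_0 -> N) : sat c u <-> forall v : 'I_n -> N, sat p v.
  rewrite /c sat_Alls; split=> h w; have := h w; first by rewrite sat_rename tcat_lshift.
  by rewrite sat_rename tcat_lshift.
apply: (cE M (e \o @tnil K)).1; apply: (eel 0 c (@tnil K)).2.
exact: (cE K (@tnil K)).2.
Qed.

(** * Existence and nontriviality in a monster extension *)

Section MonsterExtension.
Variables (L : language) (K : structure L) (d : forall n, set ('I_n -> K) -> option nat).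
Arguments d : clear implicits.
Hypothesis dF : dimension_function d.
Hypothesis dD : dim_definable d.

(** A formula of dimension 0 at [b] need not be narrow, as other parameters may give it dimension 1.
    Conjoining the negation of the [q] that describes those parameters makes it narrow and changes
    nothing at [b]. *)
Lemma dim_cl_ext_cl (M : structure L) (e : K -> M) : elementary e ->
  dim_cl d = restrict_cl e (ext_cl d (M := M)).
Proof.
move=> eel; apply/funext => A; apply/seteqP; split=> a.
  move=> [X [[m [p [b [bA ->]]]] dX pa]]; have [q qP] := @dD 1 m p 1 isT.
  have rE (N : structure L) (y : 'I_m -> N) x :
      sat (fAnd (p : formula L m.+1) (fNot (frename q (lift ord0)))) (tcons x y) = (sat p (tcons x y) /\ ~ sat q y).
    by rewrite sat_And sat_Not sat_rename comp_lift0.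
  exists m, (fAnd (p : formula L m.+1) (fNot (frename q (lift ord0)))), (e \o b); split.
  - move=> y; have [qy|nqy] := pselect (sat q y).
      set X' := defset _ _; suff -> : X' = set0 by exact: thin0.
      by apply/seteqP; split=> // x; rewrite /X' (tuple1 x) sat_defset1 rE => -[].
    have pt : thin d (@defset L K 1 m p y) by move=> /qP.
    apply: thin_sub pt => //; [exact: (@definable_defset _ _ 1)|exact: definable_defset|].
    by move=> x; rewrite (tuple1 x) !sat_defset1 rE => -[].
  - by move=> _ [j _ <-]; exists (b j) => //; apply: bA; exists j.
  - rewrite rE -comp_tcons !(sat_elementary eel) -sat_defset1; split=> // /qP.
    by rewrite dX.
move=> [m [p [c [np cA pc]]]].
have /choice[b bP] j : exists b, A b /\ e b = c j.
  by have [|b ? ?] := cA (c j); [exists j|exists b].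
have ec : c = e \o b by apply/funext => j /=; case: (bP j).
move: pc; rewrite ec -comp_tcons (sat_elementary eel) -sat_defset1 => pb.
exists (@defset L K 1 m p b); split=> //.
- by exists m, p, b; split=> // _ [j _ <-]; case: (bP j).
- apply: thin_dim => //; first exact: definable_defset.
  by exists (fun=> a).
Qed.

Variables (kappa : Type) (M : structure L) (e : K -> M).
Hypothesis eel : elementary e.
Hypothesis mM : monster kappa M.
Let kinf := monster_infinite mM.

(** Stands in for dimension 1 in [M], where [d] is not defined. *)
Definition wide m (t : formula L m.+1) (b : 'I_m -> M) :=
  forall k (r : formula L k.+1) (c : 'I_k -> M), dim_narrow d r ->
    exists x, sat t (tcons x b) /\ ~ sat r (tcons x c).

(** For a fixed [r], that [q(y)] prevents [r(x, z)] from covering [t(x, y)] is a first-order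
    statement; it holds in [K] because a set of dimension 1 is not contained in a thin one. *)
Lemma wide_of_dim m (t : formula L m.+1) (q : formula L m) (b : 'I_m -> M) :
  (forall y : 'I_m -> K, d 1 (@defset L K 1 m t y) = Some 1 <-> sat q y) -> sat q b -> wide t b.
Proof.
move=> qP qb k r c nr.
pose s : formula L (m + k) := Imp (frename q (lshift k))
  (fEx (fAnd (@params_formula L 1 _ _ (lshift k) t) (fNot (@params_formula L 1 _ _ (@rshift m k) r)))).
have sE (N : structure L) (y : 'I_m -> N) (z : 'I_k -> N) :
    sat s (tcat y z) = (sat q y -> exists x, sat t (tcons x y) /\ ~ sat r (tcons x z)).
  rewrite /s sat_Imp sat_rename tcat_lshift sat_Ex; congr (_ -> _); apply: eq_exists => x.
  rewrite sat_And sat_Not -(@sat_defset1 _ N _ (@params_formula L 1 _ _ (lshift k) t)) defset_params.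
  rewrite -(@sat_defset1 _ N _ (@params_formula L 1 _ _ (@rshift m k) r)) defset_params.
  by rewrite tcat_lshift tcat_rshift !sat_defset1.
have : sat s (tcat b c); last by rewrite sE; apply.
apply: (elementary_forall eel) => w; rewrite -(tcat_split w) sE => /qP dt.
apply: contrapT => /forallNP h.
apply: (thin_sub dF _ _ _ (nr (w \o @rshift m k))) dt.
- exact: (@definable_defset _ _ 1).
- exact: (@definable_defset _ _ 1).
- move=> x; rewrite (tuple1 x) !sat_defset1 => tx; apply: contrapT => nrx.
  by apply: (h (x ord0)).
Qed.

(** If [q] failed at [b], then [t] conjoined with the negation of [q] would be a narrow formula
    putting [a] in the closure of [b]. *)
Lemma wide_of_not_cl m (t : formula L m.+1) (b : 'I_m -> M) a :
  sat t (tcons a b) -> ~ ext_cl d (range b) a -> wide t b.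
Proof.
move=> ta na; have [q qP] := @dD 1 m t 1 isT.
apply: (wide_of_dim qP); apply: contrapT => nq; apply: na.
have rE (N : structure L) (y : 'I_m -> N) x :
    sat (fAnd t (fNot (frename q (lift ord0)))) (tcons x y) = (sat t (tcons x y) /\ ~ sat q y).
  by rewrite sat_And sat_Not sat_rename comp_lift0.
exists m, (fAnd t (fNot (frename q (lift ord0)))), b; split=> //; last by rewrite rE.
move=> y; have [qy|nqy] := pselect (sat q y).
  set X' := defset _ _; suff -> : X' = set0 by exact: thin0.
  by apply/seteqP; split=> // x; rewrite /X' (tuple1 x) sat_defset1 rE => -[].
have pt : thin d (@defset L K 1 m t y) by move=> /qP.
apply: thin_sub pt => //; [exact: (@definable_defset _ _ 1)|exact: (@definable_defset _ _ 1)|].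
by move=> x; rewrite (tuple1 x) !sat_defset1 rE => -[].
Qed.

Definition pform m (p : formula L m.+1) (b : 'I_m -> M) : pformula1 M := existT _ m (p, b).

(** Saturation is applied to [P] with the negations of all narrow formulas over [D]. A finite part
    contains finitely many of these; the disjunction of the narrow formulas is narrow, so the wide
    [t] has a point outside it. *)
Lemma realize_wide (D : set M) (P : set (pformula1 M)) : small kappa D ->
  (forall q, P q -> range (projT2 q).2 `<=` D) ->
  (forall F, finite_set F -> F `<=` P -> exists m (t : formula L m.+1) (b : 'I_m -> M),
     wide t b /\ forall x, sat t (tcons x b) -> forall q, F q -> psat q x) ->
  exists a, (forall q, P q -> psat q a) /\ ~ ext_cl d D a.
Proof.
move=> sD PD wP; case: mM => _ sat_M _.
pose N : set (pformula1 M) := [set q | exists k (r : formula L k.+1) (c : 'I_k -> M),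
  [/\ dim_narrow d r, range c `<=` D & q = pform (fNot r) c]].
have [|F Ffin FPN|a aPN] := sat_M D (P `|` N) sD.
- by move=> q [/PD//|[k [r [c [_ cD ->]]]]].
- have [||m [t [b [wt tF]]]] := wP (F `&` P); [exact: finite_setIl|by move=> q []|].
  suff [k [r [c [nr rF]]]] : exists k (r : formula L k.+1) (c : 'I_k -> M), dim_narrow d r /\
      forall x, ~ sat r (tcons x c) -> forall q, (F `\` P) q -> psat q x.
    have [x [tx nrx]] := wt k r c nr; exists x => q Fq.
    by have [Pq|nPq] := pselect (P q); [apply: tF|apply: rF].
  have /finite_set_range[n [v ev]] : finite_set (F `\` P) by apply: finite_setD.
  have vN i : N (v i).
    have [Fv nPv] : (F `\` P) (v i) by rewrite ev; exists i.
    by case: (FPN _ Fv).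
  rewrite ev => {ev}; elim: n v vN => [|n IH] v vN.
    exists 0, (Bot L 1), (@tnil M); split=> [y|x _ q [[]]//].
    rewrite (_ : defset _ _ = set0); first exact: thin0.
    by apply/seteqP; split.
  have [k [r [c [nr hr]]]] := IH (v \o lift ord0) (fun i => vN _).
  have [k' [r' [c' [nr' _ ev]]]] := vN ord0.
  pose r2 := fOr (@params_formula L 1 _ _ (lshift k') r) (@params_formula L 1 _ _ (@rshift k k') r').
  have r2E (S : structure L) (y : 'I_(k + k') -> S) :
      @defset L S 1 _ r2 y = @defset L S 1 _ r (y \o lshift k') `|` @defset L S 1 _ r' (y \o @rshift k k').
    by rewrite /r2 defset_Or !defset_params.
  exists (k + k'), r2, (tcat c c'); split=> [y|x].
    rewrite r2E; apply: thin_setU => //; exact: (@definable_defset _ _ 1).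
  rewrite -sat_defset1 r2E tcat_lshift tcat_rshift => /not_orP[].
  rewrite !sat_defset1 => nrx nr'x q [i _ <-].
  case: (unliftP ord0 i) => [j|] ->; last by rewrite ev.
  by apply: (hr x nrx); exists j.
exists a; split=> [q Pq|[m [p [b [np bD pa]]]]]; first by apply: aPN; left.
have : psat (pform (fNot p) b) a by apply: aPN; right; exists m, p, b.
exact.
Qed.

(** [P] is the type of [a] over [B]. A finite part of it is implied by a single formula true of [a],
    which is wide since [a] is not in the closure of [B]. *)
Lemma ext_cl_existence : existence kappa (ext_cl d (M := M)).
Proof.
move=> a B C sB sC na.
pose P : set (pformula1 M) := [set q | range (projT2 q).2 `<=` B /\ psat q a].
have [|q [qB _] x /qB|F Ffin FP|a' [a'P na']] := @realize_wide (B `|` C) P.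
- exact: small_setU.
- by left.
- suff [m [t [b [bB ta tF]]]] : exists m (t : formula L m.+1) (b : 'I_m -> M),
      [/\ range b `<=` B, sat t (tcons a b) &
          forall x, sat t (tcons x b) -> forall q, F q -> psat q x].
    exists m, t, b; split=> //; apply: (wide_of_not_cl ta).
    by apply: contra_not na; apply: ext_cl_mono.
  have [n [v ev]] := finite_set_range Ffin.
  have vP i : P (v i) by apply: FP; rewrite ev; exists i.
  rewrite ev => {Ffin FP ev}; elim: n v vP => [|n IH] v vP.
    exists 0, (Imp (Bot L 1) (Bot L 1)), (@tnil M); split=> [x [[]]//|//|x _ q [[]]//].
  have [m [t [b [bB ta tF]]]] := IH (v \o lift ord0) (fun i => vP _).
  case ev: (v ord0) (vP ord0) => [m' [t' b']] [/= b'B t'a].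
  pose t2 := fAnd (@params_formula L 1 _ _ (lshift m') t) (@params_formula L 1 _ _ (@rshift m m') t').
  have t2E x : sat t2 (tcons x (tcat b b')) = (sat t (tcons x b) /\ sat t' (tcons x b')).
    by rewrite -sat_defset1 /t2 defset_And !defset_params tcat_lshift tcat_rshift -!sat_defset1.
  exists (m + m'), t2, (tcat b b'); split=> [|//|x].
  + by rewrite range_tcat => x [/bB|/b'B].
  + by rewrite t2E.
  + rewrite t2E => -[tx t'x] q [i _ <-]; case: (unliftP ord0 i) => [j|] ->; last by rewrite ev.
    by apply: (tF x tx); exists j.
exists a'; split=> // m p b bB; split=> [pa|pa'].
  by apply: (a'P (pform p b)); split.
apply: contrapT => npa.
suff : psat (pform (fNot p) b) a' by exact.
by apply: a'P; split.
Qed.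

Lemma ext_cl_existential : existential kappa (ext_cl d (M := M)).
Proof.
split; [exact: ext_cl_matroid|exact: ext_cl_definable|exact: ext_cl_existence|].
have [q qP] := @dD 1 0 (Imp (Bot L 1) (Bot L 1)) 1 isT.
(* The line has dimension 1, hence is wide, and saturation yields a point outside the closure of the
   empty set. *)
have wT : wide (Imp (Bot L 1) (Bot L 1)) (@tnil M).
  apply: (wide_of_dim qP); rewrite (_ : @tnil M = e \o @tnil K); last by apply/funext => -[].
  rewrite (sat_elementary eel) -qP defset_Top.
  by case: dF => -[].
have [|q' []|F _ F0|a [_ na]] := @realize_wide set0 set0.
- exact: small_finite.
- exists 0, (Imp (Bot L 1) (Bot L 1)), (@tnil M); split=> // x _ q' /F0 [].
- by move=> /(_ set0) e0; apply: na; rewrite e0.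
Qed.

End MonsterExtension.

(** * Structures with one marked element *)

Section Swap.
Variable T : Type.
Implicit Types a b x y : T.

Definition swap a b x := if `[< x = a >] then b else if `[< x = b >] then a else x.

Lemma swapL a b : swap a b a = b. Proof. by rewrite /swap asboolT. Qed.

Lemma swapR a b : swap a b b = a.
Proof. by rewrite /swap; case: asboolP => // _; rewrite asboolT. Qed.

Lemma swapD a b x : x <> a -> x <> b -> swap a b x = x.
Proof. by move=> xa xb; rewrite /swap !asboolF. Qed.

Lemma swapK a b : involutive (swap a b).
Proof.
move=> x; have [->|xa] := pselect (x = a); first by rewrite swapL swapR.
by have [->|xb] := pselect (x = b); [rewrite swapR swapL|rewrite !swapD].
Qed.

Lemma swap_bij a b : bijective (swap a b).
Proof. by exists (swap a b); apply: swapK. Qed.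

End Swap.

Lemma cantor X : ~ ([set: set X] #<= [set: X]).
Proof.
move=> /card_le_rel[R [Rtot Rinj]]; pose D : set X := [set x | exists2 A, R A x & ~ A x].
have [x _ RDx] := Rtot D I.
have nD : ~ D x by move=> Dx; have [A RA] := Dx; rewrite (Rinj A D x).
by apply: (nD); exists D.
Qed.

Lemma bijective_of_inj_surj T U (f : T -> U) :
  injective f -> (forall y, exists x, f x = y) -> bijective f.
Proof. by move=> finj /choice[g gK]; exists g => // x; apply: finj; rewrite gK. Qed.

Definition pred_language : language :=
  @Language void (fun=> 0) nat (fun=> 1).

(* By Cantor's theorem, this makes the theory small. *)
Definition pred_carrier : Type := set (formula pred_language 0).

(** The full set [setT] is then visibly a second point, which makes [pred_cl] nontrivial. *)
Definition marked : pred_carrier := set0.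

Definition pred_structure (i : nat) : structure pred_language :=
  @Structure pred_language pred_carrier
    (fun f _ => match f with end)
    (fun r v => r = i /\ v ord0 = marked).

Definition pred_cl (X : set pred_carrier) : set pred_carrier := X `|` [set marked].

Lemma pred_infinite : infinite_set [set: pred_carrier].
Proof.
have inf := @theory_infinite _ (pred_structure 0).
move=> fin; apply: inf; apply: card_le_finite fin; apply/card_le_rel.
exists (fun p A => A = [set p]); split=> [p _|p p' A _ _ -> e]; first by exists [set p].
by have : [set p] p by []; rewrite e.
Qed.

Lemma pred_small_theory i : small pred_carrier (theory (pred_structure i)).
Proof.
apply: smallP => h; apply: (@cantor (formula pred_language 0)).
exact: card_le_trans h (card_leT _).
Qed.

Lemma pred_large (A : set pred_carrier) :
  small pred_carrier A -> [set: pred_carrier] #<= ~` A.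
Proof.
move=> sA; apply: contrapT => /smallP sC.
have [_] := small_setU pred_infinite sA sC; apply.
by rewrite setUv; apply: card_lexx.
Qed.

Lemma pred_fresh (A : set pred_carrier) : small pred_carrier A -> exists x, ~ A x.
Proof.
move=> [_ nA]; apply/existsNP => h; apply: nA.
by rewrite (_ : A = setT) ?card_lexx //; apply/seteqP; split.
Qed.

Section OneStructure.
Variable i : nat.
Local Notation M := (pred_structure i).
Implicit Types A B X : set M.

Lemma pred_automorphism (g : M -> M) : bijective g -> g marked = marked -> automorphism g.
Proof.
move=> gb gm; split=> // r v /=; split=> -[-> e]; split=> //; last by rewrite /= e.
by apply: (bij_inj gb); rewrite gm.
Qed.

Lemma pred_swap x y : x <> marked -> y <> marked -> @automorphism _ M (swap x y).
Proof. by move=> /nesym xm /nesym ym; apply: pred_automorphism; [apply: swap_bij|apply: swapD]. Qed.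

(** The transposition of [x] and [y] fixes [marked] and the parameters, hence is an automorphism
    over them. *)
Lemma pred_same_type B m (p : formula pred_language m.+1) (b : 'I_m -> M) x y :
  range b `<=` B -> ~ pred_cl B x -> ~ pred_cl B y ->
  @sat _ M _ p (tcons x b) = @sat _ M _ p (tcons y b).
Proof.
move=> bB nx ny.
have xm : x <> marked by move=> e; apply: nx; right.
have ym : y <> marked by move=> e; apply: ny; right.
rewrite -(sat_aut (pred_swap xm ym)) comp_tcons swapL; congr (sat _ (tcons _ _)).
apply/funext => j /=; apply: swapD => e.
  by apply: nx; left; apply: bB; exists j.
by apply: ny; left; apply: bB; exists j.
Qed.

Lemma pred_small_cl B : small pred_carrier B -> small pred_carrier (pred_cl B).
Proof.
move=> sB; apply: small_setU => //; first exact: pred_infinite.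
by apply: small_finite => //; apply: pred_infinite.
Qed.

(* All points outside the parameters of a formula and different from [marked]
   have the same type over them: a type that is not realized is contradicted by one
   formula at those points, and by one more formula at each of the others. *)
Lemma pred_saturated : saturated pred_carrier M.
Proof.
move=> B P sB PB Pfin; have [u nu] := pred_fresh (pred_small_cl sB).
apply: contrapT => /forallNP nreal.
have omit x : exists q, P q /\ ~ psat q x.
  by have /existsNP[q /not_implyP hq] := nreal x; exists q.
have /choice[f fP] := omit.
pose D := pred_cl (range (projT2 (f u)).2).
have [|q [->|[x _ <-]]|a aF] := Pfin ([set f u] `|` f @` D).
- rewrite finite_setU; split; first exact: finite_set1.
  apply: finite_image; rewrite /D /pred_cl finite_setU; split; first exact: finite_range.
  exact: finite_set1.
- by case: (fP u).
- by case: (fP x).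
have [Da|nDa] := pselect (D a).
  by case: (fP a) => _; apply; apply: aF; right; exists a.
have nDu : ~ D u.
  apply: contra_not nu => -[h|h]; [left|by right].
  by apply: PB h; case: (fP u).
case: (fP u) => _; apply; have := aF (f u) (or_introl erefl).
by rewrite /psat (pred_same_type _ _ nDa nDu).
Qed.

(** Equality makes [f] injective on [A], and the predicate [P_i] makes it respect [marked]. After
    adding [marked] to the domain, the complements of the domain and of the image both have the size
    of the carrier, so a bijection between them completes [f] to a permutation. *)
Lemma pred_homogeneous : strongly_homogeneous pred_carrier M.
Proof.
move=> A f sA fel.
have finj x y : A x -> A y -> f x = f y -> x = y.
  move=> Ax Ay fxy.
  have := fel 2 (Eq (Var pred_language ord0) (Var pred_language ord_max)) (tcons x (fun _ : 'I_1 => y)).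
  have om : ord_max = lift ord0 ord0 :> 'I_2 by apply/val_inj.
  rewrite /= om !tcons0 !tconsS => h; apply/h => //.
  by move=> _ [k _ <-]; rewrite /tcons; case: unliftP.
have fm x : A x -> f x = marked <-> x = marked.
  move=> Ax; have rx : range (fun _ : 'I_1 => x) `<=` A by move=> _ [_ _ <-].
  have h := fel 1 (@Rel pred_language 1 i (fun=> Var pred_language ord0)) _ rx.
  by split=> e; [have [] := h.1 (conj erefl e)|have [] := h.2 (conj erefl e)].
pose A' := A `|` [set marked].
pose f' x := if `[< x = marked >] then marked else f x.
have f'm : f' marked = marked by rewrite /f' asboolT.
have f'f x : A x -> f' x = f x.
  by move=> Ax; rewrite /f'; case: asboolP => // /(fm _ Ax).2.
have f'inj x y : A' x -> A' y -> f' x = f' y -> x = y.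
  move=> [Ax|->] [Ay|->]; rewrite ?f'm ?f'f //.
  - exact: finj.
  - by move=> /(fm _ Ax).1.
  - by move=> /esym/(fm _ Ay).1.
have sA' : small pred_carrier A' by apply: pred_small_cl.
have /card_set_bijP[h [hfun hinj hsurj]] : (~` A') #= (~` (f' @` A')).
  apply: Cantor_Bernstein; apply: card_le_trans (card_leT _) _; apply: pred_large => //.
  by apply: small_image => //; apply: pred_infinite.
pose g x := if `[< A' x >] then f' x else h x.
have gA x : A' x -> g x = f' x by move=> A'x; rewrite /g asboolT.
have gN x : ~ A' x -> g x = h x by move=> A'x; rewrite /g asboolF.
exists g; split; last by move=> x Ax; rewrite gA ?f'f //; left.
apply: pred_automorphism; last by rewrite gA //; right.
apply: bijective_of_inj_surj => [x y|y].
  have [Ax|nAx] := pselect (A' x); have [Ay|nAy] := pselect (A' y).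
  - by rewrite !gA //; apply: f'inj.
  - rewrite gA // gN // => e; have := hfun _ nAy; case; rewrite -e; by exists x.
  - rewrite gN // gA // => e; have := hfun _ nAx; case; rewrite e; by exists y.
  - by rewrite !gN //; apply: hinj; apply/mem_set.
have [[x A'x <-]|ny] := pselect ((f' @` A') y); first by exists x; rewrite gA.
by have [x nx <-] := hsurj _ ny; exists x; rewrite gN.
Qed.

Lemma pred_monster : monster pred_carrier M.
Proof. by split; [apply: pred_small_theory|apply: pred_saturated|apply: pred_homogeneous]. Qed.

Lemma pred_matroid : matroid pred_cl.
Proof.
split.
- by move=> X x Xx; left.
- by move=> X Y XY; apply: setSU.
- by move=> X; rewrite /pred_cl -setUA setUid.
- move=> X; apply/seteqP; split=> [x [Xx|xm]|x [A [_ AX]]].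
  + by exists [set x]; split; [exact: finite_set1|move=> _ ->|left].
  + by exists set0; split=> //; right.
  + by apply: setSU.
- by move=> X a c [[[Xa|->]|am] na]; [case: na; left|left; right|case: na; right].
Qed.

Lemma pred_existential : existential pred_carrier (pred_cl : set M -> set M).
Proof.
split; first exact: pred_matroid.
- move=> A; apply/seteqP; split=> [a [Aa|am]|a [m [p [b [np bA pa]]]]].
  + exists 1, (point_formula pred_language), (fun=> a); split.
    * move=> x y; rewrite -(@sat_defset1 pred_language M 1 (point_formula pred_language)).
      rewrite (tuple1 y) defset_point => /(congr1 (@^~ ord0)) /= ->.
      by left; exists ord0.
    * by move=> _ [_ _ <-].
    * by rewrite -(@sat_defset1 pred_language M 1 (point_formula pred_language)) defset_point.
  (* The point [marked] enters the closure through [P_i], a narrow formula that depends on [i]. *)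
  + exists 0, (@Rel pred_language 1 i (fun=> Var pred_language ord0)), (@tnil M); split.
    * by move=> x b [_]; rewrite /= tcons0 => ->; right.
    * by move=> x [[]].
    * by rewrite /= tcons0.
  + by apply: setSU (np _ _ pa).
- move=> a B C sB sC na.
  have [|a' na'] := @pred_fresh (pred_cl (B `|` C)).
    by apply: pred_small_cl; apply: small_setU => //; apply: pred_infinite.
  have nBa' : ~ pred_cl B a'.
    by apply: contra_not na' => -[Ba'|->]; [left; left|right].
  exists a'; split=> // m p b bB.
  by rewrite (pred_same_type p bB na nBa').
- move=> /(_ set0) e; have : pred_cl set0 setT by rewrite e.
  case=> // /= e'; have : (setT : pred_carrier) (Bot _ 0) by [].
  by rewrite e'.
Qed.

(** Each structure is its own monster model, with its carrier as [kappa]. *)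
Definition pred_ematroid : ematroid M :=
  EMatroid (@elementary_id _ M) pred_monster pred_existential.

(* Points of [J] should differ from [marked], which no formula independent of [i]
   describes.  Asking that they can avoid an arbitrary [w] is equivalent, since
   they can be moved by automorphisms. *)
Lemma pred_dim_ge n m (p : formula pred_language (n + m)) (y : 'I_m -> M) k :
  dim_ge (pred_cl : set M -> set M) (range y) (defset p y) k <->
  exists J : {set 'I_n}, k <= #|J| /\ forall w : M, exists x : 'I_n -> M,
    @sat _ M _ p (tcat x y) /\ forall j, j \in J ->
      [/\ x j <> w, forall l, x j <> y l & forall j', j' \in J -> j' <> j -> x j <> x j'].
Proof.
split=> [[x px [J iJ kJ]]|[J [kJ /(_ marked)[x [px xJ]]]]]; last first.
  exists x => //; exists J => // j Jj; have [xm xy xx] := xJ j Jj.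
  move=> [[[l _ /esym/xy//]|[j' [Jj' jj'] /esym]]|//].
  exact: xx.
exists J; split=> // w.
have xm j : j \in J -> x j <> marked by move=> Jj e; apply: (iJ j Jj); right.
have xy j l : j \in J -> x j <> y l.
  by move=> Jj e; apply: (iJ j Jj); left; left; exists l.
have xx j j' : j \in J -> j' \in J -> j' <> j -> x j <> x j'.
  by move=> Jj Jj' jj' e; apply: (iJ j Jj); left; right; exists j'.
have [[j0 Jj0 <-]|nw] := pselect (exists2 j0, j0 \in J & x j0 = w); last first.
  exists x; split=> // j Jj; split; [|move=> l; exact: xy|move=> j' Jj'; exact: xx].
  by apply: contra_not nw => <-; exists j.
have [|u nu] := @pred_fresh (pred_cl (range x `|` range y)).
  apply: pred_small_cl; apply: small_finite; first exact: pred_infinite.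
  by rewrite finite_setU; split; apply: finite_range.
have um : u <> marked by move=> e; apply: nu; right.
have ux j : x j <> u by move=> e; apply: nu; left; left; exists j.
have uy l : y l <> u by move=> e; apply: nu; left; right; exists l.
have gaut := pred_swap (xm j0 Jj0) um; set g := swap _ _ in gaut.
have ginj : injective g by apply: bij_inj; apply: swap_bij.
have gy : g \o y = y by apply/funext => l /=; apply: swapD => // /esym; apply: xy.
exists (g \o x); split; first by rewrite -{1}gy -comp_tcat (sat_aut gaut).
move=> j Jj; split.
- by move=> /= e; apply: (ux j); apply: ginj; rewrite e /g swapR.
- by move=> l; rewrite -gy => /ginj; apply: xy.
- by move=> j' Jj' jj' /ginj; apply: xx.
Qed.

End OneStructure.

(** * Uniform definability for the marked structures *)

Section UniformlyDefinable.

(** The predicate may depend on [i], the formula may not. Closure under connectives produces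
    formulas without writing them out. *)
Definition unif_def n (P : nat -> ('I_n -> pred_carrier) -> Prop) :=
  exists p : formula pred_language n, forall i v, @sat _ (pred_structure i) _ p v <-> P i v.

Lemma unif_def_ext n (P Q : nat -> ('I_n -> pred_carrier) -> Prop) :
  (forall i v, P i v <-> Q i v) -> unif_def P -> unif_def Q.
Proof. by move=> PQ [p pP]; exists p => i v; rewrite pP. Qed.

Lemma unif_def_const n (Q : Prop) : @unif_def n (fun _ _ => Q).
Proof.
have [q|nq] := pselect Q; last by exists (Bot _ n).
by exists (Imp (Bot _ n) (Bot _ n)) => i v; split=> // _ [].
Qed.

Lemma unif_def_imp n (P Q : nat -> ('I_n -> pred_carrier) -> Prop) :
  unif_def P -> unif_def Q -> unif_def (fun i v => P i v -> Q i v).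
Proof.
by move=> [p pP] [q qP]; exists (Imp p q) => i v; rewrite sat_Imp; split=> h /pP/h/qP.
Qed.

Lemma unif_def_not n (P : nat -> ('I_n -> pred_carrier) -> Prop) :
  unif_def P -> unif_def (fun i v => ~ P i v).
Proof. by move=> hP; apply: unif_def_imp hP (unif_def_const _ _). Qed.

Lemma unif_def_and n (P Q : nat -> ('I_n -> pred_carrier) -> Prop) :
  unif_def P -> unif_def Q -> unif_def (fun i v => P i v /\ Q i v).
Proof. by move=> [p pP] [q qP]; exists (fAnd p q) => i v; rewrite sat_And pP qP. Qed.

Lemma unif_def_forall_fin n (F : finType) (P : F -> nat -> ('I_n -> pred_carrier) -> Prop) :
  (forall j, unif_def (P j)) -> unif_def (fun i v => forall j, P j i v).
Proof.
move=> /choice[f fP]; exists (foldr (fun j q => fAnd (f j) q) (Imp (Bot _ n) (Bot _ n)) (enum F)) => i v.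
suff -> s : @sat _ (pred_structure i) _ (foldr (fun j q => fAnd (f j) q) (Imp (Bot _ n) (Bot _ n)) s) v <->
    forall j, j \in s -> P j i v.
  by split=> h j; [apply: h; rewrite mem_enum|move=> _; apply: h].
elim: s => [|j s IH]; first by split=> // _ [].
rewrite [foldr _ _ _]/= sat_And IH fP; split=> [[Pj Ps] k|h].
  by rewrite inE => /orP[/eqP->//|/Ps].
by split=> [|k ks]; apply: h; rewrite inE ?eqxx // ks orbT.
Qed.

Lemma unif_def_exists_fin n (F : finType) (P : F -> nat -> ('I_n -> pred_carrier) -> Prop) :
  (forall j, unif_def (P j)) -> unif_def (fun i v => exists j, P j i v).
Proof.
move=> hP; apply: (@unif_def_ext _ (fun i v => ~ forall j, ~ P j i v)).
  by move=> i v; split=> [/existsNP[j /contrapT]|[j Pj] /(_ j)//]; exists j.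
by apply: unif_def_not; apply: unif_def_forall_fin => j; apply: unif_def_not.
Qed.

Lemma unif_def_neq n (j k : 'I_n) : unif_def (fun _ v => v j <> v k).
Proof. by apply: unif_def_not; exists (Eq (Var _ j) (Var _ k)). Qed.

(** One formula serves all [i] because the criterion of [pred_dim_ge] does not mention [marked]. As
    each structure is its own monster model, this covers [definable_dim] and [uniformly_definable]
    alike. *)
Lemma pred_dim_definable n m (p : formula pred_language (n + m)) l :
  exists q : formula pred_language m, forall i (y : 'I_m -> pred_structure i),
    dim_over (pred_cl : set (pred_structure i) -> _) (range y) (defset p y) = Some l <-> sat q y.
Proof.
suff ge k : unif_def (fun i (y : 'I_m -> pred_structure i) =>
    dim_ge (pred_cl : set (pred_structure i) -> _) (range y) (defset p y) k).
  have [q qP] := unif_def_and (ge l) (unif_def_not (ge l.+1)).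
  by exists q => i y; rewrite dim_overP qP.
apply: unif_def_ext; first by move=> i v; apply: iff_sym; apply: pred_dim_ge.
apply: unif_def_exists_fin => J; apply: unif_def_and; first exact: unif_def_const.
(* The slot between [x] and the parameters is reserved for [w], which [p] must skip. *)
pose s : 'I_(n + m) -> 'I_(n + m.+1) := tcat (lshift m.+1) (fun l => rshift n (lift ord0 l)).
have [q qP] : unif_def (fun i (u : 'I_(n + m.+1) -> pred_structure i) =>
    @sat _ (pred_structure i) _ p (u \o s) /\ forall j : 'I_n, j \in J ->
    u (lshift m.+1 j) <> u (rshift n ord0) /\
    (forall l, u (lshift m.+1 j) <> u (rshift n (lift ord0 l))) /\
    (forall j', j' \in J -> j' <> j -> u (lshift m.+1 j) <> u (lshift m.+1 j'))).
  apply: unif_def_and; first by exists (frename p s) => i v; rewrite sat_rename.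
  apply: unif_def_forall_fin => j; apply: unif_def_imp; first exact: unif_def_const.
  apply: unif_def_and; first exact: unif_def_neq.
  apply: unif_def_and.
    by apply: unif_def_forall_fin => k'; apply: unif_def_neq.
  apply: unif_def_forall_fin => j'; apply: unif_def_imp; first exact: unif_def_const.
  by apply: unif_def_imp; [exact: unif_def_const|exact: unif_def_neq].
exists (All (fExs q)) => i y.
have e (x : 'I_n -> pred_structure i) w : tcat x (tcons w y) \o s = tcat x y.
  rewrite /s comp_tcat tcat_lshift; congr tcat; apply/funext => j /=.
  by rewrite tcatR tconsS.
rewrite sat_All; split=> h w; have := h w.
  rewrite sat_Exs => -[x /qP[+ xJ]]; rewrite e => px; exists x; split=> // j /xJ.
  rewrite !tcatL !tcatR tcons0 => -[xw [xy xx]]; split=> // [k'|j' Jj' jj'].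
    by have := xy k'; rewrite tcatR tconsS.
  by have := xx j' Jj' jj'; rewrite tcatL.
move=> [x [px xJ]]; rewrite sat_Exs; exists x; apply/qP; rewrite e; split=> // j /xJ[xw xy xx].
rewrite !tcatL !tcatR tcons0; split=> //; split=> [k'|j' Jj' jj'].
  by rewrite tcatR tconsS.
by rewrite tcatL; apply: xx.
Qed.

End UniformlyDefinable.

(** * The ultraproduct of the marked structures *)

Lemma nonprincipal_ultrafilter : exists mu : set_system nat,
  UltraFilter mu /\ forall n, \forall i \near mu, i <> n.
Proof.
have [mu [Umu oomu]] := @ultraFilterLemma nat \oo eventually_filter.
exists mu; split=> // n; apply: oomu; exists n.+1 => // i /= ni e.
by rewrite e ltnn in ni.
Qed.

Section PredUltraproduct.
Variable mu : set_system nat.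
Context {Umu : UltraFilter mu}.
Hypothesis mu_nonprincipal : forall n, \forall i \near mu, i <> n.
Local Notation U := (ultraproduct mu pred_structure).

Lemma pred_definable_dim i : definable_dim (pred_ematroid i).
Proof.
by move=> n m p l _; have [q qP] := pred_dim_definable p l; exists q => y; apply: qP.
Qed.

Lemma pred_uniformly_definable : uniformly_definable pred_ematroid.
Proof.
move=> n m p l _; have [q qP] := pred_dim_definable p l; exists q => i y.
apply: iff_trans (qP i y); exact: (edim_defset (pred_ematroid i)).
Qed.

Lemma pred_ultraproduct_automorphism (g : U -> U) : bijective g -> automorphism g.
Proof.
move=> gb; split=> // r v; have no (w : 'I_1 -> U) : ~ @rinterp _ U r w.
  move=> h; apply: (@filter_not_empty _ mu _).
  by apply: filterS2 h (mu_nonprincipal r) => i [-> _] /(_ erefl).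
by split=> /no.
Qed.

(** A nonempty set of points defined without parameters is invariant under all permutations, hence
    is the whole line, of dimension 1. *)
Lemma pred_not_dim_cl (a : U) : ~ dim_cl (udim pred_ematroid) set0 a.
Proof.
move=> [X [[k [p [v [v0 ->]]]] dX pa]].
have eT : defset p v = setT.
  apply/seteqP; split=> // x _; rewrite (tuple1 x) sat_defset1.
  move: pa; rewrite sat_defset1.
  rewrite -(sat_aut (pred_ultraproduct_automorphism (swap_bij a (x ord0)))) comp_tcons swapL.
  suff -> : swap a (x ord0) \o v = v by [].
  by apply/funext => j; case: (v0 (v j)); exists j.
have [[_ _ dT] _ _ _] := udim_dimension pred_definable_dim pred_uniformly_definable.
by move: dX; rewrite eT dT.
Qed.

End PredUltraproduct.

(** [ultra_dim] constrains [d] on definable sets only, so uniqueness is stated there. The matroid is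
    required to come from an existential one on every monster extension, so nothing depends on a
    choice of [M]. *)
Theorem theorem12p4 :
  (forall (L : language) (I : Type) (mu : set_system I) (Umu : UltraFilter mu)
     (K : I -> structure L) (E : forall i, ematroid (K i)),
     infinite_set [set: I] ->
     (forall i, definable_dim (E i)) ->
     uniformly_definable E ->
     exists d : forall n, set ('I_n -> ultraproduct mu K) -> option nat,
       [/\ ultra_dim E d,
           forall d' : forall n, set ('I_n -> ultraproduct mu K) -> option nat,
             ultra_dim E d' ->
             forall n (X : set ('I_n -> ultraproduct mu K)), definable X -> d' n X = d n X,
           dimension_function d,
           matroid (dim_cl d) /\
           (forall (kappa : Type) (M : structure L) (e : ultraproduct mu K -> M),
              elementary e -> monster kappa M ->
              exists cl : set M -> set M,
                existential kappa cl /\ dim_cl d = restrict_cl e cl)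
         & forall (a : forall i, K i) m (b : forall i, 'I_m -> K i),
             dim_cl d (range (utuple mu b)) (uclass mu a) ->
             \forall i \near mu, mcl (E i) (range (b i)) (a i)])
  /\
  (exists (L : language) (I : Type) (mu : set_system I) (Umu : UltraFilter mu)
     (K : I -> structure L) (E : forall i, ematroid (K i))
     (d : forall n, set ('I_n -> ultraproduct mu K) -> option nat)
     (a : forall i, K i) (m : nat) (b : forall i, 'I_m -> K i),
     infinite_set [set: I] /\
     (forall i, definable_dim (E i)) /\
     uniformly_definable E /\
     ultra_dim E d /\
     (\forall i \near mu, mcl (E i) (range (b i)) (a i)) /\
     ~ dim_cl d (range (utuple mu b)) (uclass mu a)).
Proof.
split.
  move=> L I mu Umu K E _ Edef Eunif; pose d := @udim L I mu Umu K E; exists d.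
  have dF : dimension_function d by exact: udim_dimension.
  have dD : dim_definable d by exact: udim_definable.
  split; [exact: ultra_dim_udim|exact: ultra_dim_unique|exact: dF| |exact: dim_cl_udim].
  split=> [|kappa M e eel mM].
    (* Taking the ultraproduct as its own extension gives the matroid axioms without a monster
       model. *)
    rewrite (dim_cl_ext_cl dF dD (@elementary_id _ (ultraproduct mu K))).
    rewrite (_ : restrict_cl _ _ = ext_cl d (M := _)); first exact: ext_cl_matroid.
    by apply/funext => X; rewrite /restrict_cl image_id.
  exists (ext_cl d (M := M)); split; first exact: (ext_cl_existential dF dD eel mM).
  exact: dim_cl_ext_cl.
have [mu [Umu mu_nonprincipal]] := nonprincipal_ultrafilter.
exists pred_language, nat, mu, Umu, pred_structure, pred_ematroid, (udim pred_ematroid).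
(* The empty tuple suffices: [marked] is in the closure of the empty set in every factor. *)
exists (fun=> marked), 0, (fun i => @tnil (pred_structure i)).
split; first exact/infiniteP.
split; first exact: pred_definable_dim.
split; first exact: pred_uniformly_definable.
split; first exact: ultra_dim_udim.
split; first by apply: filterE => i; right.
rewrite (_ : range _ = set0); first exact: pred_not_dim_cl.
by apply/seteqP; split=> // x [[]].
Qed.
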